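(* The Containment Extension problem is NP-complete.
   Context: A containment representation of a graph $G=(V,E)$ is a family (multiset) of finite sets $\{S_v : v\in V\}$ such that for all distinct $u,v\in V$, $(u,v)\in E$ iff $S_u\subseteq S_v$ or $S_v\subseteq S_u$. The Containment Extension problem: Instance: a graph $G=(V,E)$, a containment representation $\{S_v : v\in V\}$ of $G$ (given by listing the sets), and a set $A\subseteq V$. Question: is there a set $S\subseteq\bigcup_{v\in V}S_v$ such that, for every $v\in V$, ($S\subseteq S_v$ or $S_v\subseteq S$) holds if and only if $v\in A$? *)

(* Defs.v *)
From mathcomp Require Import all_boot.
From mathcomp Require Import finmap.

Set Implicit Arguments.
Unset Strict Implicit.
Unset Printing Implicit Defensive.

(** * Deterministic multi-tape Turing machines *)

Inductive direction := MoveLeft | Stay | MoveRight.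

(** A cell is blank ([None]), holds a bit ([Some (inl b)]), or holds one of the
    additional work symbols of the machine ([Some (inr a)]). *)
Definition cell (G : finType) := option (bool + G)%type.

(** A two-way infinite tape: the cells to the left of the head (nearest first),
    the scanned cell, and the cells to its right (nearest first).  All cells
    beyond the two lists are blank. *)
Record tape (G : finType) := Tape {
  tape_left : seq (cell G);
  tape_head : cell G;
  tape_right : seq (cell G) }.

Definition write (G : finType) (a : cell G) (t : tape G) : tape G :=
  Tape (tape_left t) a (tape_right t).

Definition shift (G : finType) (d : direction) (t : tape G) : tape G :=
  let: Tape l c r := t in
  match d with
  | MoveLeft => Tape (behead l) (head None l) (c :: r)
  | Stay => t
  | MoveRight => Tape (c :: l) (head None r) (behead r)
  end.

(** The machine has [extra_tapes.+1] tapes; tape [ord0] carries both the input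
    and the output. *)
Record TM := {
  state : finType;
  symbol : finType;
  extra_tapes : nat;
  start : state;
  halting : pred state;
  trans : state -> {ffun 'I_extra_tapes.+1 -> cell symbol} ->
          state * {ffun 'I_extra_tapes.+1 -> cell symbol * direction} }.

Record config (M : TM) := Config {
  cstate : state M;
  ctapes : {ffun 'I_(extra_tapes M).+1 -> tape (symbol M)} }.

Definition blank_tape (G : finType) : tape G := Tape [::] None [::].

Definition input_tape (G : finType) (w : seq bool) : tape G :=
  let s : seq (cell G) := [seq Some (inl b) | b <- w] in
  Tape [::] (head None s) (behead s).

Definition init (M : TM) (w : seq bool) : config M :=
  Config (start M)
    [ffun i => if i == ord0 then input_tape (symbol M) w
               else blank_tape (symbol M)].

(** Halting configurations are fixed points of [step]. *)
Definition step (M : TM) (c : config M) : config M :=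
  if halting (cstate c) then c else
  let: (q, a) := trans (cstate c) [ffun i => tape_head (ctapes c i)] in
  Config q [ffun i => shift (a i).2 (write (a i).1 (ctapes c i))].

Fixpoint leading_bits (G : finType) (s : seq (cell G)) : seq bool :=
  if s is Some (inl b) :: s' then b :: leading_bits s' else [::].

(** The output is the maximal block of bits that starts at the head. *)
Definition output (M : TM) (c : config M) : seq bool :=
  let t := ctapes c ord0 in leading_bits (tape_head t :: tape_right t).

(** [M] halts on [w] within [t] steps, with output [u]. *)
Definition computes_within (M : TM) (t : nat) (w u : seq bool) : Prop :=
  let c := iter t (@step M) (init M w) in halting (cstate c) /\ output c = u.

(** * P, NP and NP-completeness *)

Definition language := seq bool -> Prop.

Definition poly_time (f : seq bool -> seq bool) : Prop :=
  exists (M : TM) (c d : nat),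
    forall w, computes_within M (c * size w ^ d + c) w (f w).

Definition poly_time_pred (p : pred (seq bool)) : Prop :=
  poly_time (fun w => [:: p w]).

(** A prefix-free code for lists over a type with a prefix-free code [e]: each
    item is announced by [true], and the list is closed by [false]. *)
Definition enc_seq (T : Type) (e : T -> seq bool) (s : seq T) : seq bool :=
  foldr (fun x r => true :: e x ++ r) [:: false] s.

Definition enc_word : seq bool -> seq bool := enc_seq (fun b => [:: b]).

Definition enc_pair (x y : seq bool) : seq bool := enc_word x ++ y.

Definition NP (L : language) : Prop :=
  exists2 V : pred (seq bool), poly_time_pred V &
    exists c d : nat, forall x,
      L x <-> exists2 y : seq bool,
                size y <= c * size x ^ d + c & V (enc_pair x y).

Definition poly_reducible (L1 L2 : language) : Prop :=
  exists2 f, poly_time f & forall w, L1 w <-> L2 (f w).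

Definition NP_hard (L : language) : Prop :=
  forall L', NP L' -> poly_reducible L' L.

Definition NP_complete (L : language) : Prop := NP L /\ NP_hard L.

(** * Containment representations and their extension *)

Local Open Scope fset_scope.

Definition nested (T : choiceType) (X Y : {fset T}) : bool :=
  (X `<=` Y) || (Y `<=` X).

Definition containment_representation (V : finType) (T : choiceType)
    (E : rel V) (S : V -> {fset T}) : Prop :=
  forall u v, u != v -> E u v = nested (S u) (S v).

Definition has_containment_extension (V : finType) (T : choiceType)
    (S : V -> {fset T}) (A : {set V}) : Prop :=
  exists2 X : {fset T}, X `<=` \big[fsetU/fset0]_(v : V) S v &
    forall v, nested X (S v) = (v \in A).

(** The elements of the sets are named by words, and each set is given by an
    arbitrary listing of its elements. *)
Record instance := Instance {
  nvert : nat;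
  edge : rel 'I_nvert;
  listing : 'I_nvert -> seq (seq bool);
  target : {set 'I_nvert} }.

Definition set_of (I : instance) (v : 'I_(nvert I)) : {fset seq bool} :=
  [fset x in listing v].

Definition well_formed (I : instance) : Prop :=
  [/\ symmetric (@edge I), irreflexive (@edge I)
    & containment_representation (@edge I) (@set_of I)].

Definition enc_instance (I : instance) : seq bool :=
  let V := enum 'I_(nvert I) in
  enc_seq enc_word [seq [seq edge u v | v <- V] | u <- V]
  ++ enc_seq (enc_seq enc_word) [seq listing v | v <- V]
  ++ enc_word [seq v \in target I | v <- V].

Definition ContainmentExtension : language := fun w =>
  exists I : instance,
    [/\ w = enc_instance I, well_formed I
      & has_containment_extension (@set_of I) (target I)].

(* Main.v *)
(** Membership in NP: a certificate is the list of the sets together with the new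
    set; all the rest of the instance, including the adjacency matrix and the
    target set, is determined by these and can be recomputed and compared.

    Hardness: only instances with [A] empty are needed, where one looks for a set
    that is incomparable with every given set.  With an element [d] forced out of
    the new set [X] and an element [e] forced into it, incomparability with the
    complement of [C] (containing [d]) says that [X] meets [C], and
    incomparability with a set [F] avoiding [e] says that [X] does not contain
    [F].  Any constraint satisfaction problem given by forbidden combinations of
    values of slots is of this form: the elements are the pairs (slot, value),
    [C] ranges over the sets of all pairs with a given slot and [F] over the
    forbidden combinations.  No consistency constraint is needed, since any choice
    of one value per slot from [X] is a solution.  The computation of a Turing
    machine is such a problem, with one slot for every time [t] and column [j].
    Tapes are drawn relative to their heads, so that moving a head shifts the
    whole tape by one column; then the slot [(t+1, j+1)] is a function of the slots
    [(t, j)], [(t, j+1)], [(t, j+2)] and of the slot in the head column, uniformly in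
    [t] and [j].  The slots outside the light cone of the final head position are
    not controlled by the initial row, which is harmless.

    Polynomial time: functions are computed by programs of a small language of
    stacks of bits, which compiles to multi-tape machines.  The functions so
    computed are closed under composition, pairing, case distinction and those
    iterations whose intermediate results have polynomial size, hence under the
    usual list combinators. *)

From mathcomp Require Import all_boot finmap zify.
From Stdlib Require Import FunctionalExtensionality.
Require Import Defs.

Set Implicit Arguments.
Unset Strict Implicit.
Unset Printing Implicit Defensive.

(** * Stack programs and their compilation to Turing machines *)

Definition store := nat -> seq bool.

Definition upd (s : store) (i : nat) (w : seq bool) : store :=
  fun j => if j == i then w else s j.

Inductive cmd :=
  | Push (i : nat) (b : bool)
  | Pop (i : nat)
  | Seq (c1 c2 : cmd)
  | If (i : nat) (ctrue cfalse cempty : cmd)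
  | While (i : nat) (c : cmd).

Definition branch (T : Type) (w : seq bool) (xtrue xfalse xempty : T) : T :=
  match w with [::] => xempty | true :: _ => xtrue | false :: _ => xfalse end.

(** The last index is only an upper bound on the running time, by [run_weaken]. A [Push] costs two
    units because its compiled form first moves the head left and then writes. *)
Inductive run : cmd -> store -> store -> nat -> Prop :=
  | run_push i b s : run (Push i b) s (upd s i (b :: s i)) 2
  | run_pop i s : run (Pop i) s (upd s i (behead (s i))) 1
  | run_seq c1 c2 s s1 s2 m n :
      run c1 s s1 m -> run c2 s1 s2 n -> run (Seq c1 c2) s s2 (m + n)
  | run_if i c1 c2 c3 s s' n :
      run (branch (s i) c1 c2 c3) s s' n -> run (If i c1 c2 c3) s s' n.+1
  | run_while0 i c s : s i = [::] -> run (While i c) s s 1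
  | run_whileS i c s s1 s2 m n : s i != [::] ->
      run c s s1 m -> run (While i c) s1 s2 n ->
      run (While i c) s s2 (m + n).+1
  | run_weaken c s s' m n : run c s s' m -> m <= n -> run c s s' n.

Fixpoint max_register (c : cmd) : nat :=
  match c with
  | Push i _ | Pop i => i
  | Seq c1 c2 => maxn (max_register c1) (max_register c2)
  | If i c1 c2 c3 =>
      maxn i (maxn (max_register c1) (maxn (max_register c2) (max_register c3)))
  | While i c => maxn i (max_register c)
  end.

(** * The finite control of a command and its simulation on tapes *)

Notation bcell := (cell void).
Notation btape := (tape void).

(** Control states are positions in the syntax tree. The state [None] of [If] and of [While] is the
    one that performs the test. *)
Fixpoint control (c : cmd) : finType :=
  match c with
  | Push _ _ => bool
  | Pop _ => unit
  | Seq c1 c2 => (control c1 + control c2)%type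
  | If _ c1 c2 c3 => option (control c1 + (control c2 + control c3))
  | While _ c => option (control c)
  end.

Fixpoint entry (c : cmd) : control c :=
  match c return control c with
  | Push _ _ => false
  | Pop _ => tt
  | Seq c1 c2 => inl (entry c1)
  | If _ _ _ _ | While _ _ => None
  end.

Definition action := option (nat * (bcell * direction)).

Definition cell_branch (T : Type) (x : bcell) (xtrue xfalse xempty : T) : T :=
  match x with
  | Some (inl true) => xtrue | Some (inl false) => xfalse | _ => xempty
  end.

(** Lifts a transition of a subcommand to the enclosing command: its states are embedded by [f], and
    its termination is redirected to [e]. *)
Definition exit_to (Q Q' : Type) (f : Q -> Q') (e : option Q')
  (x : option Q * action) : option Q' * action :=
  (if x.1 is Some q then Some (f q) else e, x.2).

(** The next control state is [None] when the command terminates. *)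
Fixpoint next (c : cmd) : control c -> (nat -> bcell) -> option (control c) * action :=
  match c return control c -> (nat -> bcell) -> option (control c) * action with
  | Push i b => fun q v =>
      if q then (None, Some (i, (Some (inl b), Stay)))
      else (Some true, Some (i, (v i, MoveLeft)))
  | Pop i => fun _ _ => (None, Some (i, (None, MoveRight)))
  | Seq c1 c2 => fun q v =>
      match q with
      | inl q1 => exit_to inl (Some (inr (entry c2))) (@next c1 q1 v)
      | inr q2 => exit_to inr None (@next c2 q2 v)
      end
  | If i c1 c2 c3 => fun q v =>
      match q with
      | None => (Some (Some (cell_branch (v i) (inl (entry c1))
                   (inr (inl (entry c2))) (inr (inr (entry c3))))), None)
      | Some (inl q1) => exit_to (Some \o inl) None (@next c1 q1 v)
      | Some (inr (inl q2)) => exit_to (Some \o (inr \o inl)) None (@next c2 q2 v)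
      | Some (inr (inr q3)) => exit_to (Some \o (inr \o inr)) None (@next c3 q3 v)
      end
  | While i c => fun q v =>
      match q with
      | None => (cell_branch (v i) (Some (Some (entry c))) (Some (Some (entry c))) None,
                 None)
      | Some q => exit_to Some (Some None) (@next c q v)
      end
  end.

Section Compile.

Variable K : nat.

Definition tapes := {ffun 'I_K.+1 -> btape}.

Definition act (a : action) (t : tapes) : tapes :=
  [ffun j => if a is Some (i, (x, d)) then
     if j == inord i then shift d (write x (t j)) else t j else t j].

Definition heads (t : tapes) : nat -> bcell := fun i => tape_head (t (inord i)).

Definition cstep (c : cmd) (x : option (control c) * tapes) :
    option (control c) * tapes :=
  if x.1 is Some q then
    let: (q', a) := next q (heads x.2) in (q', act a x.2)
  else x.

(** The top of a stack is under the head and the rest lies to its right. Nothing is said about the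
    cells to the left, since a push overwrites the one it enters. *)
Definition represents (t : tapes) (s : store) : Prop :=
  forall i, i <= K -> forall j,
    nth None (tape_head (t (inord i)) :: tape_right (t (inord i))) j
    = nth None [seq Some (inl b) : bcell | b <- s i] j.

Lemma iter_cstep_none (c : cmd) n t :
  iter n (@cstep c) (None, t) = (None, t).
Proof. by elim: n => //= n ->. Qed.

(** Once [c] has terminated it idles, whereas [c'] goes on from [e]. Hence only the number [m] of
    steps up to the termination of [c] carries over, not the bound [n]. *)
Lemma embed_run (c c' : cmd) (f : control c -> control c') e :
  (forall q v, next (f q) v = exit_to f e (next q v)) ->
  forall n q t t', iter n (@cstep c) (Some q, t) = (None, t') ->
  exists2 m, m <= n & iter m (@cstep c') (Some (f q), t) = (e, t').
Proof.
move=> H; elim=> [|n IHn] q t t' //.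
rewrite iterSr {2}/cstep /=.
case E: (next q _) => [[q'|] a] /=.
  move/IHn => [m le_mn Em]; exists m.+1 => //.
  by rewrite iterSr {2}/cstep /= H E /= Em.
rewrite iter_cstep_none => -[<-]; exists 1 => //=.
by rewrite /cstep /= H E.
Qed.

Lemma represents_act t s i x d w :
  i <= K -> represents t s ->
  (forall j, nth None (let u := shift d (write x (t (inord i))) in
       tape_head u :: tape_right u) j
    = nth None [seq Some (inl b) : bcell | b <- w] j) ->
  represents (act (Some (i, (x, d))) t) (upd s i w).
Proof.
move=> iK R H i' i'K j; rewrite /act ffunE /upd.
have -> : (inord i' == inord i :> 'I_K.+1) = (i' == i).
  by rewrite -val_eqE /= !inordK.
by case: eqP => [->|_]; [exact: H | exact: R].
Qed.

Lemma represents_heads t s i (T : Type) (a b c : T) :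
  i <= K -> represents t s ->
  cell_branch (heads t i) a b c = branch (s i) a b c.
Proof.
move=> iK /(_ i iK 0) /=; rewrite /heads => ->.
by case: (s i) => [|[] w].
Qed.

Lemma act_none t : act None t = t.
Proof. by apply/ffunP => j; rewrite ffunE. Qed.

Lemma iter_add_to (T : Type) (f : T -> T) m n x y z :
  iter m f x = y -> iter n f y = z -> iter (m + n) f x = z.
Proof. by move=> <- <-; rewrite addnC iterD. Qed.

Lemma compile_run c s s' n : run c s s' n ->
  max_register c <= K -> forall t, represents t s ->
  exists2 t', represents t' s' &
    iter n (@cstep c) (Some (entry c), t) = (None, t').
Proof.
elim=> {c s s' n} /=.
- move=> i b s iK t R.
  set a1 : action := Some (i, (heads t i, MoveLeft)).
  exists (act (Some (i, (Some (inl b), Stay))) (act a1 t)); last by [].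
  (* The intermediate tape only represents a stack after the write, so the two
     moves are combined by hand. *)
  move=> i' i'K j; rewrite /act !ffunE /upd /a1.
  have [->|/negPf ne] := eqVneq i' i; last first.
    have -> : (inord i' == inord i :> 'I_K.+1) = false.
      by rewrite -val_eqE /= !inordK.
    exact: R.
  rewrite eqxx; have := R i iK; rewrite /heads.
  case: (t (inord i)) => l h r /=.
  by case: j => [|j] //= /(_ j).
- move=> i s iK t R; exists (act (Some (i, (None, MoveRight))) t) => //.
  apply: represents_act => // j.
  have /= := R i iK j.+1.
  case: (t (inord i)) => l h r /=.
  have -> : nth None (head None r :: behead r) j = nth None r j.
    by case: r; case: j => //= j; rewrite nth_nil.
  by move=> ->; case: (s i) => //=; rewrite nth_nil.
- move=> c1 c2 s s1 s2 m n _ IH1 _ IH2; rewrite geq_max => /andP [K1 K2] t R.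
  have [t1 R1 E1] := IH1 K1 t R.
  have [t2 R2 E2] := IH2 K2 t1 R1.
  exists t2 => //.
  have [//|m' le_m Em] :=
    @embed_run c1 (Seq c1 c2) inl (Some (inr (entry c2))) _ _ _ _ _ E1.
  have [//|n' le_n En] := @embed_run c2 (Seq c1 c2) inr None _ _ _ _ _ E2.
  have -> : m + n = (m' + n') + (m + n - (m' + n')) by lia.
  apply: iter_add_to; first exact: iter_add_to Em En.
  exact: (@iter_cstep_none (Seq c1 c2)).
- move=> i c1 c2 c3 s s' n _ IH; rewrite !geq_max => /and4P [iK K1 K2 K3] t R.
  have start : cstep (Some (entry (If i c1 c2 c3)), t) =
      (Some (Some (branch (s i) (inl (entry c1))
                   (inr (inl (entry c2))) (inr (inr (entry c3))))), t).
    by rewrite /cstep /= act_none (represents_heads _ _ _ iK R).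
  have finish c (f : control c -> control (If i c1 c2 c3)) t' :
      (forall q v, next (f q) v = exit_to f None (next q v)) ->
      iter n (@cstep c) (Some (entry c), t) = (None, t') ->
      iter n (@cstep (If i c1 c2 c3)) (Some (f (entry c)), t) = (None, t').
    move=> H /(embed_run H) [m le_m Em].
    rewrite -(subnKC le_m); apply: iter_add_to Em _.
    exact: iter_cstep_none.
  case E: (s i) IH start => [|[] w] /= IH start.
  + have [t' R' E'] := IH K3 t R; exists t' => //.
    rewrite -iterS iterSr start.
    exact: (@finish c3 (Some \o (inr \o inr))).
  + have [t' R' E'] := IH K1 t R; exists t' => //.
    rewrite -iterS iterSr start.
    exact: (@finish c1 (Some \o inl)).
  + have [t' R' E'] := IH K2 t R; exists t' => //.
    rewrite -iterS iterSr start.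
    exact: (@finish c2 (Some \o (inr \o inl))).
- move=> i c s si0; rewrite geq_max => /andP [iK cK] t R.
  exists t => //=; rewrite /cstep /= act_none.
  by rewrite (represents_heads _ _ _ iK R) si0.
- move=> i c s s1 s2 m n si0 _ IH1 _ IH2 wK t R.
  have /andP [iK cK] : (i <= K) && (max_register c <= K) by rewrite -geq_max.
  have start : cstep (Some (entry (While i c)), t) =
      (Some (Some (entry c)), t).
    rewrite /cstep /= act_none (represents_heads _ _ _ iK R).
    by case: (s i) si0 => [|[]].
  have [t1 R1 E1] := IH1 cK t R.
  have [t2 R2 E2] := IH2 wK t1 R1.
  exists t2 => //.
  have [//|m' le_m Em] := @embed_run c (While i c) Some (Some None) _ _ _ _ _ E1.
  rewrite -iterS iterSr start.
  have -> : m + n = m' + n + (m + n - (m' + n)) by lia.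
  apply: iter_add_to; first exact: iter_add_to Em E2.
  exact: (@iter_cstep_none (While i c)).
- move=> c s s' m n _ IH le_mn cK t R.
  have [t' R' E'] := IH cK t R; exists t' => //.
  rewrite -(subnKC le_mn); apply: iter_add_to E' _.
  exact: iter_cstep_none.
Qed.

End Compile.

Definition compiled_trans K (c : cmd) (q : option (control c))
    (v : {ffun 'I_K.+1 -> bcell}) :
    option (control c) * {ffun 'I_K.+1 -> bcell * direction} :=
  if q is Some q then
    let: (q', a) := next q (fun i => v (inord i)) in
    (q', [ffun j => if a is Some (i, x) then
                      if j == inord i then x else (v j, Stay)
                    else (v j, Stay)])
  else (None, [ffun j => (v j, Stay)]).

Definition compile (c : cmd) : TM :=
  {| state := option (control c); symbol := void; extra_tapes := max_register c;
     start := Some (entry c); halting := fun q => q == None;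
     trans := @compiled_trans (max_register c) c |}.

Lemma write_head (G : finType) (t : tape G) : shift Stay (write (tape_head t) t) = t.
Proof. by case: t. Qed.

Lemma step_compile c q (t : tapes (max_register c)) :
  @step (compile c) (@Config (compile c) q t) =
  let x := cstep (q, t) in @Config (compile c) x.1 x.2.
Proof.
rewrite /step /=; case: q => [q|] //=.
rewrite /cstep /=.
have -> : (fun i => [ffun i0 => tape_head (t i0)] (inord i)) = heads t.
  by apply: functional_extensionality => i; rewrite ffunE.
case: (next q (heads t)) => q' a /=; congr Config.
apply/ffunP => j; rewrite !ffunE.
case: a => [[i [x d]]|]; last exact: write_head.
by case: (j == inord i) => //; exact: write_head.
Qed.

Lemma iter_step_compile c n q (t : tapes (max_register c)) :
  iter n (@step (compile c)) (@Config (compile c) q t) =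
  let x := iter n (@cstep _ c) (q, t) in @Config (compile c) x.1 x.2.
Proof.
elim: n => //= n ->; rewrite step_compile.
by case: (iter n _ _).
Qed.

Definition init_store (w : seq bool) : store := upd (fun _ => [::]) 0 w.

Lemma leading_bits_nth (s : seq bcell) (w : seq bool) :
  (forall j, nth None s j = nth None [seq Some (inl b) | b <- w] j) ->
  leading_bits s = w.
Proof.
elim: s w => [|x s IHs] [|b w] H //=.
- by have := H 0.
- by have /= -> := H 0.
- by have /= -> := H 0; congr cons; apply: IHs => j; have := H j.+1.
Qed.

Lemma run_computes c w s n : run c (init_store w) s n ->
  computes_within (compile c) n w (s 0).
Proof.
move=> R; set K := max_register c.
set t : tapes K := [ffun i => if i == ord0 then input_tape void w else blank_tape void].
have Rt : represents t (init_store w).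
  move=> i iK j; rewrite ffunE /init_store /upd.
  have -> : (inord i == ord0 :> 'I_K.+1) = (i == 0).
    by rewrite -val_eqE /= inordK.
  case: (i == 0) => /=; last by case: j => [|[|j]].
  by case: w {R t} => [|b w] /=; [case: j => [|[|j]] | ].
have [t' Rt' E] := compile_run R (leqnn _) Rt.
have EI : iter n (@step (compile c)) (init (compile c) w) =
   @Config (compile c) None t' by rewrite iter_step_compile E.
rewrite /computes_within EI; split => //; rewrite /output /=.
apply: (@leading_bits_nth (tape_head (t' ord0) :: tape_right (t' ord0))) => j.
have := Rt' 0 (leq0n _) j.
by have -> : inord 0 = ord0 :> 'I_K.+1 by apply: val_inj; rewrite /= inordK.
Qed.

(** * Polynomial bounds and elementary programs *)

(** The base is at least 2, so that a large exponent absorbs constants and sums, and a single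
    parameter suffices. *)
Definition polyb (p : nat -> nat) : Prop := exists d, forall n, p n <= (n + 2) ^ d.

Lemma polyb_le p q : (forall n, p n <= q n) -> polyb q -> polyb p.
Proof. by move=> H [d Hd]; exists d => n; exact: leq_trans (H n) (Hd n). Qed.

Lemma polyb_id : polyb id.
Proof. by exists 1 => n; rewrite expn1 /=; lia. Qed.

Lemma leq_expl m n d : m <= n -> m ^ d <= n ^ d.
Proof. by move=> le_mn; case: d => // d; rewrite leq_exp2r. Qed.

Lemma polyb_const c : polyb (fun _ => c).
Proof.
exists c => n; apply: leq_trans (_ : 2 ^ c <= _); first exact/ltnW/ltn_expl.
by apply: leq_expl; lia.
Qed.

Lemma polyb_mul p q : polyb p -> polyb q -> polyb (fun n => p n * q n).
Proof.
by move=> [d Hd] [e He]; exists (d + e) => n; rewrite expnD leq_mul.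
Qed.

Lemma polyb_add p q : polyb p -> polyb q -> polyb (fun n => p n + q n).
Proof.
move=> [d Hd] [e He]; exists (d + e).+1 => n; rewrite expnS expnD.
have := Hd n; have := He n.
have : 0 < (n + 2) ^ d by rewrite expn_gt0; lia.
have : 0 < (n + 2) ^ e by rewrite expn_gt0; lia.
move: ((n + 2) ^ d) ((n + 2) ^ e) => x y; nia.
Qed.

Lemma polyb_exp p d : polyb p -> polyb (fun n => p n ^ d).
Proof.
move=> Hp; elim: d => [|d IHd].
  exact: polyb_const.
by apply: polyb_le (polyb_mul Hp IHd) => n; rewrite expnS.
Qed.

Lemma polyb_comp p q : polyb p -> polyb q -> polyb (fun n => p (q n)).
Proof.
move=> [d Hd] Hq; apply: polyb_le (fun n => Hd (q n)) _.
by apply: polyb_exp; apply: polyb_add Hq (polyb_const 2).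
Qed.

Lemma polyb_bound p : polyb p -> exists c d, forall n, p n <= c * n ^ d + c.
Proof.
(* For positive [n] one has [n + 2 <= 3 * n]; at [n = 0] the additive constant takes over. *)
move=> [d Hd]; exists (3 ^ d), d => n; apply: leq_trans (Hd n) _.
case: n => [|n]; last first.
  by rewrite -expnMn; apply: leq_trans (leq_addr _ _); apply: leq_expl; lia.
by apply: leq_trans (leq_addl _ _); apply: leq_expl.
Qed.

Ltac polyb := repeat first
  [ assumption | apply: polyb_id | apply: polyb_const
  | apply: polyb_add | apply: polyb_mul | apply: polyb_exp ].

(** Total, because the decoding program runs on arbitrary words: an unterminated code yields the
    bits read so far and an empty second component. *)
Fixpoint unpair (w : seq bool) : seq bool * seq bool :=
  match w with
  | true :: b :: w' => let: (u, v) := unpair w' in (b :: u, v)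
  | false :: w' => ([::], w')
  | _ => ([::], [::])
  end.

Lemma enc_pairK x y : unpair (enc_pair x y) = (x, y).
Proof.
rewrite /enc_pair; elim: x => //= b x IHx; rewrite /enc_word /= in IHx *.
by rewrite IHx.
Qed.

Lemma size_unpair w : size (unpair w).1 + size (unpair w).2 <= size w.
Proof.
have [n] := ubnP (size w); elim: n w => // n IHn [|[] [|b w]] //= lt_w.
have := IHn w; case: (unpair w) => u v /=; lia.
Qed.

Lemma size_enc_word x : size (enc_word x) = (2 * size x).+1.
Proof. by elim: x => //= b x; rewrite /enc_word /= => ->; lia. Qed.

Lemma size_enc_pair x y : size (enc_pair x y) = 2 * size x + 1 + size y.
Proof. by rewrite /enc_pair size_cat size_enc_word; lia. Qed.

(** Time bounds growth; this is why outputs computed in polynomial time have polynomial size. *)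
Lemma size_run c s s' n : run c s s' n -> forall i, size (s' i) <= size (s i) + n.
Proof.
elim=> {c s s' n}.
- by move=> i b s j; rewrite /upd; case: eqP => [->|_] /=; lia.
- by move=> i s j; rewrite /upd; case: eqP => [->|_]; rewrite ?size_behead; lia.
- by move=> c1 c2 s s1 s2 m n _ H1 _ H2 i; have := H1 i; have := H2 i; lia.
- by move=> i c1 c2 c3 s s' n _ H j; have := H j; lia.
- by move=> i c s _ j; lia.
- by move=> i c s s1 s2 m n _ _ H1 _ H2 j; have := H1 j; have := H2 j; lia.
- by move=> c s s' m n _ H le_mn i; have := H i; lia.
Qed.

Lemma upd_same s i w : upd s i w i = w.
Proof. by rewrite /upd eqxx. Qed.

Lemma upd_other s i j w : j != i -> upd s i w j = s j.
Proof. by rewrite /upd => /negPf ->. Qed.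

Ltac store := try (apply: functional_extensionality => ?); rewrite /upd;
  repeat (case: eqP => //= ?; try lia; try congruence); subst; try congruence.

Lemma run_eq c s s1 s2 m n : run c s s1 m -> s1 = s2 -> m <= n -> run c s s2 n.
Proof. by move=> R <- /(run_weaken R). Qed.

(** * Register routines: clearing, moving, copying, encoding and decoding *)

Definition clear i := While i (Pop i).

Lemma run_clear i s : run (clear i) s (upd s i [::]) (3 * size (s i) + 1).
Proof.
move E: (s i) => w; elim: w s E => [|b w IHw] s E.
  apply: (run_eq (run_while0 _ E)) => //; store.
have ne : s i != [::] by rewrite E.
have E' : upd s i (behead (s i)) i = w by rewrite upd_same E.
apply: run_eq (run_whileS ne (run_pop i s) (IHw _ E')) _ _ => /=; last by lia.
by store.
Qed.

Definition feed i (c : bool -> cmd) :=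
  While i (If i (Seq (Pop i) (c true)) (Seq (Pop i) (c false)) (Pop i)).

Lemma run_feed0 i c s : s i = [::] -> run (feed i c) s s 1.
Proof. exact: run_while0. Qed.

Lemma run_feedS i c s s1 s2 b w k m : s i = b :: w ->
  run (c b) (upd s i w) s1 k -> run (feed i c) s1 s2 m ->
  run (feed i c) s s2 (k + m + 3).
Proof.
move=> E R1 R2; have ne : s i != [::] by rewrite E.
have R3 : run (Seq (Pop i) (c b)) s s1 (1 + k).
  by apply: run_seq (run_pop _ _) _; rewrite E.
apply: run_eq (run_whileS ne (run_if (n := 1 + k) _) R2) _ _ => //; last by lia.
by rewrite E /=; case: (b) R3.
Qed.

Definition move_to i j := feed i (fun b => Push j b).

Lemma run_move i j s : i != j ->
  run (move_to i j) s (upd (upd s i [::]) j (rev (s i) ++ s j)) (5 * size (s i) + 1).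
Proof.
move=> /eqP ne; move E: (s i) => w; elim: w s E => [|b w IHw] s E.
  by apply: run_eq (run_feed0 _ E) _ _ => //=; store.
have E' : upd (upd s i w) j (b :: upd s i w j) i = w by store.
apply: run_eq (run_feedS E (run_push j b (upd s i w)) (IHw _ E')) _ _ => /=; last by lia.
by rewrite rev_cons cat_rcons; store.
Qed.

Definition copy_to i j k := feed i (fun b => Seq (Push j b) (Push k b)).

Lemma run_copy i j k s : i != j -> i != k -> j != k ->
  run (copy_to i j k) s
    (upd (upd (upd s i [::]) j (rev (s i) ++ s j)) k (rev (s i) ++ s k))
    (7 * size (s i) + 1).
Proof.
move=> /eqP ij /eqP ik /eqP jk; move E: (s i) => w; elim: w s E => [|b w IHw] s E.
  by apply: run_eq (run_feed0 _ E) _ _ => //=; store.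
set s1 := upd (upd s i w) j (b :: s j).
have R : run (Seq (Push j b) (Push k b)) (upd s i w) (upd s1 k (b :: s1 k)) (2 + 2).
  by apply: run_seq (run_push _ _ _) (run_eq (run_push _ _ _) _ _) => //; rewrite /s1; store.
have E' : upd s1 k (b :: s1 k) i = w by rewrite /s1; store.
apply: run_eq (run_feedS E R (IHw _ E')) _ _ => /=; last by lia.
by rewrite rev_cons !cat_rcons /s1; store.
Qed.

Definition encode_to i j :=
  Seq (Push j false) (feed i (fun b => Seq (Push j b) (Push j true))).

Lemma run_encode i j s : i != j ->
  run (encode_to i j) s
    (upd (upd s i [::]) j (enc_word (rev (s i)) ++ s j))
    (7 * size (s i) + 3).
Proof.
move=> /eqP ij.
(* The flattened list is [enc_word] without its closing [false], which is already on stack [j] when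
   the loop starts. *)
have R s1 : run (feed i (fun b => Seq (Push j b) (Push j true))) s1
    (upd (upd s1 i [::]) j
       (flatten [seq [:: true; b] | b <- rev (s1 i)] ++ s1 j)) (7 * size (s1 i) + 1).
  move E: (s1 i) => w; elim: w s1 E => [|b w IHw] s1 E.
    by apply: run_eq (run_feed0 _ E) _ _ => //=; store.
  set s2 := upd (upd s1 i w) j (b :: s1 j).
  have R : run (Seq (Push j b) (Push j true)) (upd s1 i w)
               (upd s2 j (true :: s2 j)) (2 + 2).
    by apply: run_seq (run_eq (run_push _ _ _) _ _) (run_push _ _ _) => //; rewrite /s2; store.
  have E' : upd s2 j (true :: s2 j) i = w by rewrite /s2; store.
  apply: run_eq (run_feedS E R (IHw _ E')) _ _ => /=; last by lia.
  rewrite rev_cons map_rcons flatten_rcons -!catA /s2; store.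
apply: run_eq (run_seq (run_push _ _ _) (R _)) _ _.
  rewrite (upd_other _ _ (_ : i != j)) ?upd_same; last exact/eqP.
  have -> w : enc_word w = flatten [seq [:: true; b] | b <- w] ++ [:: false].
    by elim: w => //= b w IHw; rewrite -IHw.
  by rewrite -catA; store.
by rewrite upd_other; [lia | exact/eqP].
Qed.

Definition decode_to i j k :=
  While i (If i
    (Seq (Pop i) (If i (Seq (Pop i) (Push j true)) (Seq (Pop i) (Push j false)) (Pop i)))
    (Seq (Pop i) (move_to i k))
    (Pop i)).

(** Induction on a bound for the length, as one round consumes a marker together with its bit. After
    the marker [false] the remaining word goes to [k] at once and the loop ends. *)
Lemma run_decode i j k s : i != j -> i != k -> j != k ->
  run (decode_to i j k) s
    (upd (upd (upd s i [::]) j (rev (unpair (s i)).1 ++ s j))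
       k (rev (unpair (s i)).2 ++ s k))
    (10 * size (s i) + 10).
Proof.
move=> /eqP ij /eqP ik /eqP jk; have [n] := ubnP (size (s i)).
elim: n s => // n IHn s; case E: (s i) => [|[] w] /= lt_w.
- by apply: run_eq (run_while0 _ E) _ _ => //=; store.
- have ne : s i != [::] by rewrite E.
  case: w E lt_w => [|b w] E lt_w.
    have R : run (If i (Seq (Pop i) (If i (Seq (Pop i) (Push j true))
        (Seq (Pop i) (Push j false)) (Pop i))) (Seq (Pop i) (move_to i k)) (Pop i))
        s (upd s i [::]) 4.
      apply: run_if; rewrite E /=; apply: (run_seq (m := 1) (n := 2) (run_pop _ _)).
      apply: run_if; rewrite E upd_same /=; apply: run_eq (run_pop _ _) _ _ => //; store.
    apply: run_eq (run_whileS ne R (run_while0 _ _)) _ _ => /=; first [done|by store].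
  set s1 := upd (upd s i w) j (b :: s j).
  have R : run (If i (Seq (Pop i) (If i (Seq (Pop i) (Push j true))
        (Seq (Pop i) (Push j false)) (Pop i))) (Seq (Pop i) (move_to i k)) (Pop i))
        s s1 6.
    apply: run_if; rewrite E /=; apply: (run_seq (m := 1) (n := 4) (run_pop _ _)).
    apply: run_if; rewrite E upd_same /=.
    have R b' : b = b' ->
        run (Seq (Pop i) (Push j b')) (upd s i (behead [:: true, b & w])) s1 3.
      move=> eb; apply: (run_seq (m := 1) (n := 2) (run_pop _ _)).
      by apply: run_eq (run_push _ _ _) _ _ => //; rewrite /s1 upd_same -eb /=; store.
    by case: (b) R => R; apply: R.
  have E' : s1 i = w by rewrite /s1; store.
  have := IHn s1; rewrite E' => /(_ (ltnW lt_w)) R'.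
  apply: run_eq (run_whileS ne R R') _ _; last by move=> /=; lia.
  case: (unpair w) => u v /=; rewrite rev_cons cat_rcons /s1; store.
- have ne : s i != [::] by rewrite E.
  have R : run (If i (Seq (Pop i) (If i (Seq (Pop i) (Push j true))
        (Seq (Pop i) (Push j false)) (Pop i))) (Seq (Pop i) (move_to i k)) (Pop i))
        s (upd (upd s i [::]) k (rev w ++ s k)) (5 * size w + 3).
    apply: run_weaken (run_if (n := 1 + (5 * size w + 1)) _) _; last by lia.
    rewrite E /=; apply: run_seq (run_pop _ _) _.
    have ik' : i != k by exact/eqP.
    apply: run_eq (run_move _ ik') _ _; rewrite ?E ?upd_same //=; store.
  apply: run_eq (run_whileS ne R (run_while0 _ _)) _ _ => /=.
  + by store.
  + by store.
  + lia.
Qed.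

(** * Closure properties of computable functions *)

(** A stack frame: the registers below [r] belong to the caller, those from [r] on hold [ws], and
    all later ones are empty. *)
Definition block (s : store) (r : nat) (ws : seq (seq bool)) : store :=
  fun j => if j < r then s j else nth [::] ws (j - r).

Lemma block_nth s r ws k : block s r ws (r + k) = nth [::] ws k.
Proof. by rewrite /block ltnNge leq_addr /= addKn. Qed.

Lemma upd_block s r ws k w :
  upd (block s r ws) (r + k) w = block s r (set_nth [::] ws k w).
Proof.
apply: functional_extensionality => j; rewrite /upd /block.
case: ltnP => [lt_jr|le_rj]; first by case: eqP => //; lia.
by rewrite nth_set_nth /=; do 2!case: eqP => //; lia.
Qed.

Lemma block_eq s r ws ws' : (forall k, nth [::] ws k = nth [::] ws' k) ->
  block s r ws = block s r ws'.
Proof.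
by move=> H; apply: functional_extensionality => j; rewrite /block H.
Qed.

(** A promise notion: only words of the form [i a] have to be handled. The program may depend on the
    frame offset [r] but the time bound may not, and scratch registers are left empty, so that
    programs can be nested. *)
Definition computable (A : Type) (i o : A -> seq bool) : Prop :=
  exists2 p, polyb p & forall r, exists c, forall s a,
    run c (block s r [:: i a]) (block s r [:: o a]) (p (size (i a))).

(** The form used in compositions: the bound is replaced by a power, which is monotone and also
    bounds the output, and the program acts on slot [k] of a larger frame, with the slots above [k]
    as its scratch space. *)
Lemma computableE A (i o : A -> seq bool) : computable i o ->
  exists2 p, polyb p &
   (forall a, size (o a) <= p (size (i a))) /\
   (forall m n, m <= n -> p m <= p n) /\
   forall r k, exists c, forall s ws a, size ws <= k.+1 -> nth [::] ws k = i a ->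
     run c (block s r ws) (block s r (set_nth [::] ws k (o a))) (p (size (i a))).
Proof.
move=> [p Pp Hf]; have [d Hd] : polyb (fun n => n + p n) by polyb.
exists (fun n => (n + 2) ^ d); first by exists d.
split=> [a|].
  have [c Hc] := Hf 0; have /size_run /(_ 0) := Hc (fun _ => [::]) a.
  by rewrite /block /= => /leq_trans; apply; apply: Hd.
split=> [m n le_mn|r k]; first by apply: leq_expl; lia.
have [c Hc] := Hf (r + k); exists c => s ws a le_ws E.
have shift w ws' : size ws' <= k.+1 -> nth [::] ws' k = w ->
    (forall j, j < k -> nth [::] ws j = nth [::] ws' j) ->
    block (block s r ws) (r + k) [:: w] = block s r ws'.
  move=> le_ws' <- H; apply: functional_extensionality => j; rewrite /block.
  case: (ltnP j (r + k)) => [lt_j|le_j].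
    by case: ltnP => // le_rj; apply: H; lia.
  case: ltnP => [|_]; first lia.
  have -> : j - r = k + (j - (r + k)) by lia.
  case: (j - (r + k)) => [|l]; first by rewrite addn0.
  by rewrite [RHS]nth_default /= ?nth_nil //; lia.
have := Hc (block s r ws) a; rewrite (shift (i a) ws) // (shift (o a) (set_nth [::] ws k (o a))).
- move=> /run_weaken; apply; apply: leq_trans (Hd _); lia.
- by rewrite size_set_nth; lia.
- by rewrite nth_set_nth /= eqxx.
- by move=> j lt_jk; rewrite nth_set_nth /=; case: eqP => //; lia.
Qed.

Lemma run_block_move s r ws i j : i != j ->
  run (move_to (r + i) (r + j)) (block s r ws)
    (block s r (set_nth [::] (set_nth [::] ws i [::]) j
                 (rev (nth [::] ws i) ++ nth [::] ws j)))
    (5 * size (nth [::] ws i) + 1).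
Proof.
move=> ne; have ne' : r + i != r + j by rewrite eqn_add2l.
have := run_move (block s r ws) ne'.
by rewrite !block_nth !upd_block.
Qed.

Lemma run_block_copy s r ws i j k : i != j -> i != k -> j != k ->
  run (copy_to (r + i) (r + j) (r + k)) (block s r ws)
    (block s r (set_nth [::] (set_nth [::] (set_nth [::] ws i [::]) j
                 (rev (nth [::] ws i) ++ nth [::] ws j))
                 k (rev (nth [::] ws i) ++ nth [::] ws k)))
    (7 * size (nth [::] ws i) + 1).
Proof.
move=> ij ik jk.
have [] : [/\ r + i != r + j, r + i != r + k & r + j != r + k].
  by rewrite !eqn_add2l.
move=> /(run_copy (block s r ws)) H /H {}H /H.
by rewrite !block_nth !upd_block.
Qed.

Lemma run_block_encode s r ws i j : i != j ->
  run (encode_to (r + i) (r + j)) (block s r ws)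
    (block s r (set_nth [::] (set_nth [::] ws i [::]) j
                 (enc_pair (rev (nth [::] ws i)) (nth [::] ws j))))
    (7 * size (nth [::] ws i) + 3).
Proof.
move=> ne; have ne' : r + i != r + j by rewrite eqn_add2l.
have := run_encode (block s r ws) ne'.
by rewrite !block_nth !upd_block.
Qed.

Lemma run_block_decode s r ws i j k : i != j -> i != k -> j != k ->
  run (decode_to (r + i) (r + j) (r + k)) (block s r ws)
    (block s r (set_nth [::] (set_nth [::] (set_nth [::] ws i [::]) j
                 (rev (unpair (nth [::] ws i)).1 ++ nth [::] ws j))
                 k (rev (unpair (nth [::] ws i)).2 ++ nth [::] ws k)))
    (10 * size (nth [::] ws i) + 10).
Proof.
move=> ij ik jk.
have [] : [/\ r + i != r + j, r + i != r + k & r + j != r + k].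
  by rewrite !eqn_add2l.
move=> /(run_decode (block s r ws)) H /H {}H /H.
by rewrite !block_nth !upd_block.
Qed.

Lemma run_block_clear s r ws i :
  run (clear (r + i)) (block s r ws) (block s r (set_nth [::] ws i [::]))
    (3 * size (nth [::] ws i) + 1).
Proof.
by have := run_clear (r + i) (block s r ws); rewrite !block_nth !upd_block.
Qed.

Lemma run_block_push s r ws i b :
  run (Push (r + i) b) (block s r ws)
    (block s r (set_nth [::] ws i (b :: nth [::] ws i))) 2.
Proof.
by have := run_push (r + i) b (block s r ws); rewrite !block_nth !upd_block.
Qed.

Lemma run_block_pop s r ws i :
  run (Pop (r + i)) (block s r ws)
    (block s r (set_nth [::] ws i (behead (nth [::] ws i)))) 1.
Proof.
by have := run_pop (r + i) (block s r ws); rewrite !block_nth !upd_block.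
Qed.

Ltac block_eq := apply: block_eq; do 6?case=> //=.

Lemma computable_id A (i : A -> seq bool) : computable i i.
Proof.
exists (fun _ => 3); first exact: polyb_const.
(* A push undone by a pop stands for the empty program. *)
move=> r; exists (Seq (Push (r + 0) true) (Pop (r + 0))) => s a.
exact: run_seq (run_block_push _ _ _ _ _) (run_block_pop _ _ _ _).
Qed.

Lemma computable_comp A (i m o : A -> seq bool) :
  computable i m -> computable m o -> computable i o.
Proof.
move=> /computableE [q Pq [Sq [_ Hg]]] /computableE [p Pp [_ [Mp Hf]]].
exists (fun n => q n + p (q n)); first by polyb; apply: polyb_comp.
move=> r; have [cf {}Hf] := Hf r 0; have [cg {}Hg] := Hg r 0.
exists (Seq cg cf) => s a.
apply: run_eq (run_seq (Hg s [:: i a] a _ _) (Hf s [:: m a] a _ _)) _ _ => //=.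
by rewrite leq_add2l Mp.
Qed.

Lemma computable_const A (i : A -> seq bool) u : computable i (fun _ => u).
Proof.
exists (fun n => 3 * n + 1 + 2 * size u); first by polyb.
move=> r; elim: u => [|b u [c Hc]].
  exists (clear (r + 0)) => s w; apply: run_eq (run_block_clear _ _ _ _) _ _ => //=; lia.
exists (Seq c (Push (r + 0) b)) => s w.
apply: run_eq (run_seq (Hc _ _) (run_block_push _ _ _ _ _)) _ _ => //=; lia.
Qed.

Lemma computable_cons A (i : A -> seq bool) b : computable i (fun a => b :: i a).
Proof.
exists (fun n => 2); first by polyb.
by move=> r; exists (Push (r + 0) b) => s w; exact: run_block_push.
Qed.

Lemma computable_behead A (i : A -> seq bool) : computable i (fun a => behead (i a)).
Proof.
exists (fun n => 1); first by polyb.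
by move=> r; exists (Pop (r + 0)) => s w; exact: run_block_pop.
Qed.

Lemma computable_fst A (i : A -> seq bool) : computable i (fun a => (unpair (i a)).1).
Proof.
exists (fun n => 18 * n + 13); first by polyb.
move=> r; exists (Seq (decode_to (r + 0) (r + 1) (r + 2))
   (Seq (clear (r + 2)) (move_to (r + 1) (r + 0)))) => s a.
apply: run_eq (run_seq (run_block_decode _ _ _ _ _ _)
  (run_seq (run_block_clear _ _ _ _) (run_block_move _ _ _ _))) _ _ => //=.
  by rewrite !cats0 revK; block_eq.
by rewrite !cats0 !size_rev; have := size_unpair (i a); lia.
Qed.

Lemma computable_snd A (i : A -> seq bool) : computable i (fun a => (unpair (i a)).2).
Proof.
exists (fun n => 18 * n + 13); first by polyb.
move=> r; exists (Seq (decode_to (r + 0) (r + 1) (r + 2))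
   (Seq (clear (r + 1)) (move_to (r + 2) (r + 0)))) => s a.
apply: run_eq (run_seq (run_block_decode _ _ _ _ _ _)
  (run_seq (run_block_clear _ _ _ _) (run_block_move _ _ _ _))) _ _ => //=.
  by rewrite !cats0 revK; block_eq.
by rewrite !cats0 !size_rev; have := size_unpair (i a); lia.
Qed.

Lemma computable_pair A (i f g : A -> seq bool) : computable i f -> computable i g ->
  computable i (fun a => enc_pair (f a) (g a)).
Proof.
move=> /computableE [p Pp [Sp [_ Hf]]] /computableE [q Pq [Sq [_ Hg]]].
exists (fun n => 40 * (n + p n + q n + 1)); first by polyb.
move=> r; have [cf {}Hf] := Hf r 2; have [cg {}Hg] := Hg r 3.
(* Each transfer reverses a word, so transfers come in pairs. Each subprogram works in the highest
   register in use: [f] in register 2, then [g] in register 3, to which the second copy of the input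
   is moved. *)
exists (Seq (move_to (r + 0) (r + 1)) (Seq (copy_to (r + 1) (r + 0) (r + 2))
  (Seq cf (Seq (move_to (r + 0) (r + 1)) (Seq (move_to (r + 1) (r + 3))
  (Seq cg (Seq (move_to (r + 3) (r + 1)) (Seq (move_to (r + 1) (r + 0))
  (Seq (move_to (r + 2) (r + 1)) (encode_to (r + 1) (r + 0))))))))))) => s a.
apply: run_eq.
  apply: run_seq; first exact: run_block_move.
  apply: run_seq; first exact: run_block_copy.
  rewrite /= !cats0 revK.
  apply: run_seq; first exact: (Hf _ _ a).
  apply: run_seq; first exact: run_block_move.
  apply: run_seq; first exact: run_block_move.
  rewrite /= !cats0 revK.
  apply: run_seq; first exact: (Hg _ _ a).
  apply: run_seq; first exact: run_block_move.
  apply: run_seq; first exact: run_block_move.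
  apply: run_seq; first exact: run_block_move.
  exact: run_block_encode.
  by rewrite /= !cats0 !revK; block_eq.
by rewrite /= !cats0 !size_rev; have := Sp a; have := Sq a; lia.
Qed.

(** Each branch has to work only on the inputs that select it. This matters for case analysis on
    lists, where the code can be read as a pair only if the list is nonempty. *)
Lemma computable_branch A (i f g1 g2 g3 : A -> seq bool) :
  computable i f ->
  computable (fun x : {a | ohead (f a) = Some true} => i (sval x)) (fun x => g1 (sval x)) ->
  computable (fun x : {a | ohead (f a) = Some false} => i (sval x)) (fun x => g2 (sval x)) ->
  computable (fun x : {a | ohead (f a) = None} => i (sval x)) (fun x => g3 (sval x)) ->
  computable i (fun a => branch (f a) (g1 a) (g2 a) (g3 a)).
Proof.
move=> /computableE [p Pp [Sp [_ Hf]]] /computableE [q1 Pq1 [_ [_ H1]]]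
  /computableE [q2 Pq2 [_ [_ H2]]] /computableE [q3 Pq3 [_ [_ H3]]].
exists (fun n => 40 * (n + p n + q1 n + q2 n + q3 n + 1)); first by polyb.
move=> r; have [cf {}Hf] := Hf r 2; have [c1 {}H1] := H1 r 0.
have [c2 {}H2] := H2 r 0; have [c3 {}H3] := H3 r 0.
exists (Seq (move_to (r + 0) (r + 1)) (Seq (copy_to (r + 1) (r + 0) (r + 2))
  (Seq cf (If (r + 2) (Seq (clear (r + 2)) c1) (Seq (clear (r + 2)) c2)
     (Seq (clear (r + 2)) c3))))) => s a.
have finish c (g : A -> seq bool) q o : (forall s ws (x : {a | ohead (f a) = o}),
     size ws <= 1 -> nth [::] ws 0 = i (sval x) ->
     run c (block s r ws) (block s r (set_nth [::] ws 0 (g (sval x))))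
       (q (size (i (sval x))))) -> ohead (f a) = o ->
   run (Seq (clear (r + 2)) c) (block s r [:: i a; [::]; f a]) (block s r [:: g a])
     (3 * size (f a) + 1 + q (size (i a))).
  move=> H E; apply: run_seq (run_block_clear _ _ _ _) _ => /=.
  have -> : block s r [:: i a; [::]; [::]] = block s r [:: i a] by block_eq.
  exact: (H s [:: i a] (exist _ a E)).
apply: run_eq.
  apply: run_seq; first exact: run_block_move.
  apply: run_seq; first exact: run_block_copy.
  rewrite /= !cats0 revK.
  apply: run_seq; first exact: (Hf _ _ a).
  apply: run_if (_ : run _ _ (block s r [:: branch (f a) (g1 a) (g2 a) (g3 a)])
    (3 * size (f a) + 1 + (q1 (size (i a)) + q2 (size (i a)) + q3 (size (i a))))).
  rewrite block_nth /=.
  have F1 := finish _ g1 _ _ H1; have F2 := finish _ g2 _ _ H2; have F3 := finish _ g3 _ _ H3.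
  case: (f a) F1 F2 F3 => [|[] u] F1 F2 F3 /=.
  - by apply: run_weaken (F3 erefl) _ => /=; lia.
  - by apply: run_weaken (F1 erefl) _ => /=; lia.
  - by apply: run_weaken (F2 erefl) _ => /=; lia.
  by [].
by rewrite /= !cats0 !size_rev; have := Sp a; lia.
Qed.

(** Iteration could let sizes explode; the bound [p] on all intermediate results keeps every round
    polynomial. The word [n a] is the counter, one bit being popped per round. *)
Lemma computable_iter A B (n : A -> seq bool) (z : A -> B) (h : B -> B)
    (e : B -> seq bool) p :
  computable e (fun b => e (h b)) -> polyb p ->
  (forall a k, k <= size (n a) ->
     size (e (iter k h (z a))) <= p (size (enc_pair (n a) (e (z a))))) ->
  computable (fun a => enc_pair (n a) (e (z a)))
    (fun a => e (iter (size (n a)) h (z a))).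
Proof.
move=> /computableE [q Pq [_ [Mq Hf]]] Pp Hp.
exists (fun n => 50 * ((n + 1) * (q (p n) + 1) + p n + 1)).
  by polyb; apply: polyb_comp.
move=> r; have [c {}Hf] := Hf r 3.
exists (Seq (decode_to (r + 0) (r + 1) (r + 2)) (Seq (move_to (r + 2) (r + 3))
  (Seq (While (r + 1) (Seq (Pop (r + 1)) c))
  (Seq (move_to (r + 3) (r + 2)) (move_to (r + 2) (r + 0)))))) => s a.
set w := enc_pair (n a) (e (z a)).
have loop k u x : (forall k, k <= size u -> size (e (iter k h x)) <= p (size w)) ->
   k = size u ->
   run (While (r + 1) (Seq (Pop (r + 1)) c)) (block s r [:: [::]; u; [::]; e x])
     (block s r [:: [::]; [::]; [::]; e (iter k h x)]) (k * (2 + q (p (size w))) + 1).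
  elim: u k x => [|b u IHu] [|k] x Bk //= Ek.
    by apply: run_while0; rewrite block_nth.
  case: Ek => ->; rewrite -iterS iterSr; apply: run_eq.
    apply: run_whileS; first by rewrite block_nth.
      by apply: run_seq; [exact: run_block_pop | exact: (Hf _ _ x)].
    apply: IHu; last by [].
    by move=> j le_j; rewrite /= -iterSr; apply: Bk.
    by [].
  by rewrite /=; have := Mq _ _ (Bk 0 isT); rewrite /=; lia.
apply: run_eq.
  apply: run_seq; first exact: run_block_decode.
  apply: run_seq; first exact: run_block_move.
  rewrite /= !cats0 revK enc_pairK.
  apply: run_seq; first apply: (loop (size (n a))).
  - by rewrite size_rev => k; apply: Hp.
  - by rewrite size_rev.
  apply: run_seq; first exact: run_block_move.
  exact: run_block_move.
  by rewrite /= !cats0 revK; block_eq.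
rewrite /= !cats0 !size_rev; have := Hp a _ (leqnn _); have := size_unpair w.
rewrite /w enc_pairK /=.
move: (size (n a)) (size (e (z a))) (size _) (p _) (q _) (e (iter _ _ _)) => *.
nia.
Qed.

Lemma computable_poly_time f : computable id f -> poly_time f.
Proof.
move=> /computableE [p /polyb_bound [e [d Hp]] [_ [_ H]]].
have [c Hc] := H 0 0; exists (compile c), e, d => w.
have := Hc (fun _ => [::]) [:: w] w isT erefl.
have -> : block (fun _ => [::]) 0 [:: w] = init_store w.
  apply: functional_extensionality => -[|j]; rewrite /block /init_store /upd //=.
  by rewrite nth_nil.
by move=> /run_weaken /(_ (Hp _)) /run_computes.
Qed.

(** * Polynomial time functions on coded data *)

Notation word := (seq bool).

Class codable (T : Type) := code : T -> word.

(** The priority makes a word its own code rather than a list of coded bits. Numbers are coded in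
    unary below, so that a loop of [n] rounds is polynomial in the code of [n]. *)
Instance code_word : codable word | 0 := id.
Instance code_bool : codable bool := fun b => [:: b].
Instance code_nat : codable nat := fun n => nseq n true.
Instance code_prod A B (cA : codable A) (cB : codable B) : codable (A * B) :=
  fun p => enc_pair (code p.1) (code p.2).
(** A list is coded as nested pairs, the empty list being the empty word. *)
Instance code_seq A (cA : codable A) : codable (seq A) | 10 :=
  foldr (fun x w => enc_pair (code x) w) [::].

Definition csize T (c : codable T) (x : T) : nat := size (code x).
Notation "'#[' x ]" := (csize _ x) (format "#[ x ]").

Definition FP A B (cA : codable A) (cB : codable B) (f : A -> B) : Prop :=
  computable (fun a : A => code a) (fun a => code (f a)).
Arguments FP {A B cA cB} f.

Lemma csize_pair A B (cA : codable A) (cB : codable B) (x : A) (y : B) :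
  #[(x, y)] = 2 * #[x] + 1 + #[y].
Proof. exact: size_enc_pair. Qed.

(** Pairing doubles its first component only, so the nested pairs of a list do not compound: the
    size is additive over the items. *)
Lemma csize_cons A (cA : codable A) (x : A) s : #[x :: s] = 2 * #[x] + 1 + #[s].
Proof. exact: size_enc_pair. Qed.

Lemma csize_cat A (cA : codable A) (s t : seq A) : #[s ++ t] = #[s] + #[t].
Proof. by elim: s => //= x s IHs; rewrite !csize_cons IHs; lia. Qed.

Lemma size_csize A (cA : codable A) (s : seq A) : size s <= #[s].
Proof. by elim: s => //= x s IHs; rewrite csize_cons; lia. Qed.

Lemma csize_nat n : #[n] = n.
Proof. by rewrite /csize /code /code_nat size_nseq. Qed.

Lemma computable_ext A (i o o' : A -> word) :
  computable i o -> (forall a, o a = o' a) -> computable i o'.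
Proof.
by move=> H E; have <- : o = o' by apply: functional_extensionality.
Qed.

(** A program sees only words, so it serves every family whose pairs of input and output words
    already occur in the given one. *)
Lemma computable_reindex A B (i o : B -> word) (i' o' : A -> word) :
  computable i o -> (forall a, exists b, i' a = i b /\ o' a = o b) -> computable i' o'.
Proof.
move=> [p Pp H] E; exists p => // r; have [c Hc] := H r; exists c => s a.
by have [b [-> ->]] := E a; apply: Hc.
Qed.

Lemma computable_restrict A (P : A -> Prop) (i o : A -> word) : computable i o ->
  computable (fun x : {a | P a} => i (sval x)) (fun x => o (sval x)).
Proof. by move=> H; apply: computable_reindex H _ => x; exists (sval x). Qed.

Lemma computable_branch_total A (i f g1 g2 g3 : A -> word) :
  computable i f -> computable i g1 -> computable i g2 -> computable i g3 ->
  computable i (fun a => branch (f a) (g1 a) (g2 a) (g3 a)).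
Proof.
by move=> Hf H1 H2 H3; apply: computable_branch Hf _ _ _; apply: computable_restrict.
Qed.

Lemma FP_bound A B (cA : codable A) (cB : codable B) (f : A -> B) : FP f ->
  exists2 p, polyb p & (forall m n, m <= n -> p m <= p n) /\ forall a, #[f a] <= p #[a].
Proof. by move=> /computableE [p Pp [Sp [Mp _]]]; exists p. Qed.

Lemma FP_recode A B C (cA : codable A) (cB : codable B) (cC : codable C)
  (f : A -> B) (g : A -> C) : FP f -> (forall a, code (f a) = code (g a)) -> FP g.
Proof. exact: computable_ext. Qed.

Lemma FP_ext A B (cA : codable A) (cB : codable B) (f g : A -> B) :
  FP f -> (forall a, f a = g a) -> FP g.
Proof. by move=> H E; apply: FP_recode H _ => a; rewrite E. Qed.

Lemma FP_id A (cA : codable A) : FP (fun a : A => a).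
Proof. exact: computable_id. Qed.

Lemma FP_comp A B C (cA : codable A) (cB : codable B) (cC : codable C)
  (g : B -> C) (f : A -> B) : FP g -> FP f -> FP (fun a => g (f a)).
Proof. by move=> Hg Hf; apply: computable_comp Hf (computable_reindex Hg _) => a; exists (f a). Qed.

Lemma FP_const A B (cA : codable A) (cB : codable B) (b : B) : FP (fun _ : A => b).
Proof. exact: computable_const. Qed.

Lemma FP_pair A B C (cA : codable A) (cB : codable B) (cC : codable C)
  (f : A -> B) (g : A -> C) : FP f -> FP g -> FP (fun a => (f a, g a)).
Proof. exact: computable_pair. Qed.

Lemma FP_fst A B C (cA : codable A) (cB : codable B) (cC : codable C)
  (f : A -> B * C) : FP f -> FP (fun a => (f a).1).
Proof.
apply: FP_comp; apply: computable_ext (computable_fst _) _ => p.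
by rewrite enc_pairK.
Qed.

Lemma FP_snd A B C (cA : codable A) (cB : codable B) (cC : codable C)
  (f : A -> B * C) : FP f -> FP (fun a => (f a).2).
Proof.
apply: FP_comp; apply: computable_ext (computable_snd _) _ => p.
by rewrite enc_pairK.
Qed.

Lemma FP_if A B (cA : codable A) (cB : codable B) (b : A -> bool) (f g : A -> B) :
  FP b -> FP f -> FP g -> FP (fun a => if b a then f a else g a).
Proof.
move=> Hb Hf Hg; apply: computable_ext (computable_branch_total Hb Hf Hg Hg) _ => a.
by case: (b a).
Qed.

Lemma FP_wcons A (cA : codable A) (b : A -> bool) (w : A -> word) :
  FP b -> FP w -> FP (fun a => b a :: w a).
Proof.
move=> Hb Hw; have H x := computable_comp Hw (computable_cons _ x).
apply: computable_ext (computable_branch_total Hb (H true) (H false) Hw) _ => a.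
by case: (b a).
Qed.

Lemma FP_cons A B (cA : codable A) (cB : codable B) (f : A -> B) (s : A -> seq B) :
  FP f -> FP s -> FP (fun a => f a :: s a).
Proof. by move=> Hf Hs; apply: FP_recode (FP_pair Hf Hs) _. Qed.

Lemma FP_wcase A B (cA : codable A) (cB : codable B) (w : A -> word)
    (f : A -> B) (g : A -> bool -> word -> B) :
  FP w -> FP f -> FP (fun p : A * (bool * word) => g p.1 p.2.1 p.2.2) ->
  FP (fun a => if w a is b :: v then g a b v else f a).
Proof.
move=> Hw Hf Hg.
have H b : FP (fun a => g a b (behead (w a))).
  apply: (@FP_comp _ _ _ _ _ _ (fun p : A * (bool * word) => g p.1 p.2.1 p.2.2)
    (fun a => (a, (b, behead (w a)))) Hg).
  apply: FP_pair; first exact: FP_id.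
  apply: FP_pair; first exact: FP_const.
  exact: computable_comp Hw (computable_behead _).
apply: computable_ext (computable_branch_total Hw (H true) (H false) Hf) _ => a.
by case: (w a) => [|[]].
Qed.

Lemma FP_case A B C (cA : codable A) (cB : codable B) (cC : codable C)
    (s : A -> seq C) (f : A -> B) (g : A -> C -> seq C -> B) :
  FP s -> FP f -> FP (fun p : A * (C * seq C) => g p.1 p.2.1 p.2.2) ->
  FP (fun a => if s a is x :: t then g a x t else f a).
Proof.
move=> Hs Hf Hg.
set o : A -> word := fun a => code (if s a is x :: t then g a x t else f a).
(* A nonempty list has a nonempty code, so the first symbol of the code decides the case; either bit
   leads to the same continuation [g]. *)
have ne a : s a <> [::] -> ohead (code (s a)) = Some true \/ ohead (code (s a)) = Some false.
  case E: (s a) => [|x t] // _.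
  have : size (code (x :: t)) != 0 by have := csize_cons _ x t; rewrite /csize => ->; lia.
  by case: (code _) => [|[] w] // _; [left | right].
have Hsg b : computable (fun x : {a | ohead (code (s a)) = Some b} => code (sval x))
    (fun x => o (sval x)).
  have H2 : computable (fun x : {a | ohead (code (s a)) = Some b} => code (sval x))
      (fun x => enc_pair (code (sval x)) (code (s (sval x)))).
    apply: (@computable_restrict _ _ _ (fun a => enc_pair (code a) (code (s a)))).
    exact: FP_pair (FP_id _) Hs.
  apply: computable_comp H2 (computable_reindex Hg _) => -[a Ea] /=.
  by rewrite /o; case: (s a) Ea => // x t _; exists (a, (x, t)).
have Hn : computable (fun x : {a | ohead (code (s a)) = None} => code (sval x))
    (fun x => o (sval x)).
  apply: computable_reindex Hf _ => -[a Ea] /=; exists a; split => //; rewrite /o.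
  by case E: (s a) (ne a) => [|x t] // /(_ _) []; rewrite // -E Ea.
apply: computable_ext (computable_branch Hs (Hsg true) (Hsg false) Hn) _ => a.
by case: (code (s a)) => [|[]].
Qed.

Lemma FP_witer A B (cA : codable A) (cB : codable B) (n : A -> word)
    (z : A -> B) (h : A -> B -> B) p :
  FP n -> FP z -> FP (fun q : A * B => h q.1 q.2) -> polyb p ->
  (forall a k, k <= size (n a) -> #[iter k (h a) (z a)] <= p #[a]) ->
  FP (fun a => iter (size (n a)) (h a) (z a)).
Proof.
move=> Hn Hz Hh [d Hd] Hp.
(* The parameter travels with the state, since the iterated program has access to the state only. *)
pose h' (q : A * B) := (q.1, h q.1 q.2).
have iterE k a c : iter k h' (a, c) = (a, iter k (h a) c).
  by elim: k => //= k ->.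
have Hh' : computable (fun q : A * B => code q) (fun q => code (h' q)).
  exact: FP_pair (FP_fst (FP_id _)) Hh.
have HI := @computable_iter A _ (fun a => n a) (fun a => (a, z a)) h' (fun q => code q)
  (fun m => 2 * m + 1 + (m + 2) ^ d) Hh'.
have Hi : FP (fun a => iter (size (n a)) h' (a, z a)).
  apply: computable_comp (HI _ _).
  - exact: FP_pair Hn (FP_pair (FP_id _) Hz).
  - by polyb.
  move=> a k le_k; rewrite iterE -[size (code _)]/(#[(_, _)]) csize_pair.
  have le_a : #[a] <= size (enc_pair (n a) (code (a, z a))).
    by rewrite size_enc_pair -[size (code _)]/(#[(_, _)]) csize_pair; lia.
  have := leq_expl d (leq_add le_a (leqnn 2)).
  have := Hp _ _ le_k; have := Hd (csize cA a); lia.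
apply: FP_ext (FP_snd Hi) _ => a.
by rewrite iterE.
Qed.

Lemma FP_iter A B (cA : codable A) (cB : codable B) (n : A -> nat)
    (z : A -> B) (h : A -> B -> B) p :
  FP n -> FP z -> FP (fun q : A * B => h q.1 q.2) -> polyb p ->
  (forall a k, k <= n a -> #[iter k (h a) (z a)] <= p #[a]) ->
  FP (fun a => iter (n a) (h a) (z a)).
Proof.
move=> Hn Hz Hh Pp Hp; have Hn' : FP (fun a => code (n a)) by exact: Hn.
apply: FP_ext (FP_witer Hn' Hz Hh Pp _) _ => [a k|a]; last first.
  by rewrite size_nseq.
by rewrite size_nseq; apply: Hp.
Qed.

(** If a round adds at most an amount depending on [a] alone, then the size after any number of
    rounds is at most that of the start plus rounds times this amount, which is polynomial. *)
Lemma FP_iter_add A B (cA : codable A) (cB : codable B) (n : A -> nat)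
    (z : A -> B) (h : A -> B -> B) q :
  FP n -> FP z -> FP (fun q : A * B => h q.1 q.2) -> polyb q ->
  (forall a c, #[h a c] <= #[c] + q #[a]) ->
  FP (fun a => iter (n a) (h a) (z a)).
Proof.
move=> Hn Hz Hh Pq Hq.
have [pn Ppn [_ Bn]] := FP_bound Hn; have [pz Ppz [_ Bz]] := FP_bound Hz.
apply: (@FP_iter _ _ _ _ _ _ _ (fun m => pz m + pn m * q m)) => //; first by polyb.
move=> a k le_k.
have : #[iter k (h a) (z a)] <= #[z a] + k * q #[a].
  elim: {le_k} k => [|k IHk]; first by rewrite leq_addr.
  by have := Hq a (iter k (h a) (z a)); rewrite iterS; lia.
have := Bn a; have := Bz a; rewrite csize_nat => H1 H2 H3.
have : k * q #[a] <= pn #[a] * q #[a] by apply: leq_mul => //; lia.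
lia.
Qed.

Lemma FP_foldl A B C (cA : codable A) (cB : codable B) (cC : codable C)
    (l : A -> seq B) (z : A -> C) (g : A -> B -> C -> C) q :
  FP l -> FP z -> FP (fun t : A * (B * C) => g t.1 t.2.1 t.2.2) -> polyb q ->
  (forall a x c, #[g a x c] <= #[c] + q (#[a] + #[x])) ->
  FP (fun a => foldl (fun c x => g a x c) (z a) (l a)).
Proof.
move=> Hl Hz Hg [d Hd] Hq.
(* The fold becomes an iteration on the unread list and the accumulator. Its counter is the code of
   the list, which is at least as long as the list; surplus rounds change nothing. *)
pose F a (st : seq B * C) : seq B * C :=
  if st.1 is x :: t then (t, g a x st.2) else st.
have iterE a k s c : iter k (F a) (s, c) =
    (drop k s, foldl (fun c x => g a x c) c (take k s)).
  elim: k s c => [|k IHk] s c; first by rewrite drop0 take0.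
  by rewrite iterSr; case: s => [|x s] /=; rewrite IHk.
have HF : FP (fun t : A * (seq B * C) => F t.1 t.2).
  apply: (@FP_case _ _ _ _ _ _ (fun t : A * (seq B * C) => t.2.1)
    (fun t => t.2) (fun t x u => (u, g t.1 x t.2.2))).
  - exact: FP_fst (FP_snd (FP_id _)).
  - exact: FP_snd (FP_id _).
  - apply: FP_pair; first exact: FP_snd (FP_snd (FP_id _)).
    apply: (@FP_comp _ _ _ _ _ _ (fun t : A * (B * C) => g t.1 t.2.1 t.2.2)
      (fun p : A * (seq B * C) * (B * seq B) => (p.1.1, (p.2.1, p.1.2.2))) Hg).
    apply: FP_pair; first exact: FP_fst (FP_fst (FP_id _)).
    apply: FP_pair; first exact: FP_fst (FP_snd (FP_id _)).
    exact: FP_snd (FP_snd (FP_fst (FP_id _))).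
have [pl Ppl [_ Bl]] := FP_bound Hl; have [pz Ppz [_ Bz]] := FP_bound Hz.
have Hlw : FP (fun a => code (l a)) by exact: Hl.
have HI := @FP_witer _ _ _ _ (fun a => code (l a)) (fun a => (l a, z a)) F
  (fun m => 2 * pl m + 1 + pz m + pl m * (m + pl m + 2) ^ d) Hlw (FP_pair Hl Hz) HF.
apply: FP_ext (FP_snd (HI _ _)) _ => [|a k _|a]; first by polyb.
- rewrite iterE csize_pair.
  have Hdrop : #[drop k (l a)] <= #[l a].
    by rewrite -{2}(cat_take_drop k (l a)) csize_cat leq_addl.
  have Hfold s c : #[foldl (fun c x => g a x c) c s] <=
      #[c] + size s * (#[a] + #[s] + 2) ^ d.
    elim: s c => [|x s IHs] c; first by rewrite leq_addr.
    apply: leq_trans (IHs _) _; rewrite csize_cons [size (x :: s)]/=.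
    have H1 := Hq a x c; have H2 := Hd (csize cA a + csize cB x).
    have H3 := @leq_expl (csize cA a + csize cB x + 2)
      (csize cA a + (2 * csize cB x + 1 + csize (code_seq cB) s) + 2) d.
    have H4 := @leq_expl (csize cA a + csize (code_seq cB) s + 2)
      (csize cA a + (2 * csize cB x + 1 + csize (code_seq cB) s) + 2) d.
    have {}H3 := H3 ltac:(lia); have {}H4 := H4 ltac:(lia).
    have := leq_mul (leqnn (size s)) H4; lia.
  have H1 := Hfold (take k (l a)) (z a); have H2 := Bl a; have H3 := Bz a.
  have H4 : #[take k (l a)] <= #[l a].
    by rewrite -{2}(cat_take_drop k (l a)) csize_cat leq_addr.
  have H5 : size (take k (l a)) <= pl #[a].
    by apply: leq_trans H2; apply: leq_trans H4; apply: size_csize.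
  have H6 : (#[a] + #[take k (l a)] + 2) ^ d <= (#[a] + pl #[a] + 2) ^ d.
    by apply: leq_expl; lia.
  have := leq_mul H5 H6; rewrite /=; lia.
- by rewrite iterE take_oversize //; apply: size_csize.
Qed.

Lemma FP_wfoldl A C (cA : codable A) (cC : codable C)
    (w : A -> word) (z : A -> C) (g : A -> bool -> C -> C) q :
  FP w -> FP z -> FP (fun t : A * (bool * C) => g t.1 t.2.1 t.2.2) -> polyb q ->
  (forall a x c, #[g a x c] <= #[c] + q #[a]) ->
  FP (fun a => foldl (fun c x => g a x c) (z a) (w a)).
Proof.
move=> Hw Hz Hg Pq Hq.
pose F a (st : word * C) : word * C :=
  if st.1 is x :: t then (t, g a x st.2) else st.
have iterE a k s c : iter k (F a) (s, c) =
    (drop k s, foldl (fun c x => g a x c) c (take k s)).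
  elim: k s c => [|k IHk] s c; first by rewrite drop0 take0.
  by rewrite iterSr; case: s => [|x s] /=; rewrite IHk.
have HF : FP (fun t : A * (word * C) => F t.1 t.2).
  apply: (@FP_wcase _ _ _ _ (fun t : A * (word * C) => t.2.1)
    (fun t => t.2) (fun t x u => (u, g t.1 x t.2.2))).
  - exact: FP_fst (FP_snd (FP_id _)).
  - exact: FP_snd (FP_id _).
  - apply: FP_pair; first exact: FP_snd (FP_snd (FP_id _)).
    apply: (@FP_comp _ _ _ _ _ _ (fun t : A * (bool * C) => g t.1 t.2.1 t.2.2)
      (fun p : A * (word * C) * (bool * word) => (p.1.1, (p.2.1, p.1.2.2))) Hg).
    apply: FP_pair; first exact: FP_fst (FP_fst (FP_id _)).
    apply: FP_pair; first exact: FP_fst (FP_snd (FP_id _)).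
    exact: FP_snd (FP_snd (FP_fst (FP_id _))).
have [pw Ppw [_ Bw]] := FP_bound Hw; have [pz Ppz [_ Bz]] := FP_bound Hz.
have HI := @FP_witer _ _ _ _ w (fun a => (w a, z a)) F
  (fun m => 2 * pw m + 1 + pz m + pw m * q m) Hw (FP_pair Hw Hz) HF.
apply: FP_ext (FP_snd (HI _ _)) _ => [|a k le_k|a]; first by polyb.
- rewrite iterE csize_pair.
  have Hfold s c : #[foldl (fun c x => g a x c) c s] <= #[c] + size s * q #[a].
    elim: s c => [|x s IHs] c; first by rewrite leq_addr.
    by apply: leq_trans (IHs _) _; have := Hq a x c; rewrite /=; lia.
  have H1 := Hfold (take k (w a)) (z a); have H2 := Bw a; have H3 := Bz a.
  have H4 : size (take k (w a)) <= pw #[a].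
    by rewrite size_takel //; apply: leq_trans H2.
  have H5 : #[drop k (w a)] <= #[w a] by rewrite /csize /code /code_word size_drop; lia.
  have := leq_mul H4 (leqnn (q (csize cA a))); rewrite /=; lia.
- by rewrite iterE take_size.
Qed.

(** * Boolean, arithmetical and list operations *)

Lemma FP_andb A (cA : codable A) (b c : A -> bool) : FP b -> FP c ->
  FP (fun a => b a && c a).
Proof. by move=> Hb Hc; exact: FP_if Hb Hc (FP_const _ _ false). Qed.

Lemma FP_orb A (cA : codable A) (b c : A -> bool) : FP b -> FP c ->
  FP (fun a => b a || c a).
Proof. by move=> Hb Hc; exact: FP_if Hb (FP_const _ _ true) Hc. Qed.

Lemma FP_negb A (cA : codable A) (b : A -> bool) : FP b -> FP (fun a => ~~ b a).
Proof. by move=> Hb; exact: FP_if Hb (FP_const _ _ false) (FP_const _ _ true). Qed.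

Lemma FP_eqb A (cA : codable A) (b c : A -> bool) : FP b -> FP c ->
  FP (fun a => b a == c a).
Proof.
move=> Hb Hc; apply: FP_ext (FP_if Hb Hc (FP_negb Hc)) _ => a.
by case: (b a) (c a) => [] [].
Qed.

Lemma FP_succ A (cA : codable A) (n : A -> nat) : FP n -> FP (fun a => (n a).+1).
Proof.
move=> Hn; have Hn' : FP (fun a => code (n a)) by exact: Hn.
by apply: FP_recode (FP_wcons (FP_const _ _ true) Hn') _.
Qed.

Lemma catrev_foldl T (s t : seq T) : catrev s t = foldl (fun c x => x :: c) t s.
Proof. by elim: s t => //= x s IHs t; rewrite IHs. Qed.

Lemma FP_catrev A B (cA : codable A) (cB : codable B) (s t : A -> seq B) :
  FP s -> FP t -> FP (fun a => catrev (s a) (t a)).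
Proof.
move=> Hs Ht.
apply: FP_ext (@FP_foldl _ _ _ _ _ _ s t (fun _ x c => x :: c) (fun n => 2 * n + 1)
  Hs Ht _ _ _) _.
- exact: FP_cons (FP_fst (FP_snd (FP_id _))) (FP_snd (FP_snd (FP_id _))).
- by polyb.
- by move=> a x c; rewrite csize_cons; lia.
- by move=> a; rewrite catrev_foldl.
Qed.

Lemma FP_rev A B (cA : codable A) (cB : codable B) (s : A -> seq B) :
  FP s -> FP (fun a => rev (s a)).
Proof. by move=> Hs; exact: FP_catrev Hs (FP_const _ _ [::]). Qed.

Lemma FP_cat A B (cA : codable A) (cB : codable B) (s t : A -> seq B) :
  FP s -> FP t -> FP (fun a => s a ++ t a).
Proof.
move=> Hs Ht; apply: FP_ext (FP_catrev (FP_rev Hs) Ht) _ => a.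
by rewrite catrevE revK.
Qed.

Lemma FP_wcatrev A (cA : codable A) (s t : A -> word) :
  FP s -> FP t -> FP (fun a => catrev (s a) (t a)).
Proof.
move=> Hs Ht.
apply: FP_ext (@FP_wfoldl _ _ _ _ s t (fun _ x c => x :: c) (fun n => 1)
  Hs Ht _ _ _) _.
- exact: FP_wcons (FP_fst (FP_snd (FP_id _))) (FP_snd (FP_snd (FP_id _))).
- by polyb.
- by move=> a x c; rewrite /csize /code /code_word /=; lia.
- by move=> a; rewrite catrev_foldl.
Qed.

Lemma FP_wrev A (cA : codable A) (s : A -> word) : FP s -> FP (fun a => rev (s a)).
Proof. by move=> Hs; exact: FP_wcatrev Hs (FP_const _ _ [::]). Qed.

Lemma FP_wcat A (cA : codable A) (s t : A -> word) :
  FP s -> FP t -> FP (fun a => s a ++ t a).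
Proof.
move=> Hs Ht; apply: FP_ext (FP_wcatrev (FP_wrev Hs) Ht) _ => a.
by rewrite catrevE revK.
Qed.

Lemma FP_addn A (cA : codable A) (m n : A -> nat) : FP m -> FP n ->
  FP (fun a => m a + n a).
Proof.
move=> Hm Hn; have Hm' : FP (fun a => code (m a)) by exact: Hm.
have Hn' : FP (fun a => code (n a)) by exact: Hn.
by apply: FP_recode (FP_wcat Hm' Hn') _ => a; rewrite [RHS]nseqD.
Qed.

Lemma FP_muln A (cA : codable A) (m n : A -> nat) : FP m -> FP n ->
  FP (fun a => m a * n a).
Proof.
move=> Hm Hn; have [p Pp [_ Bp]] := FP_bound Hn.
apply: FP_ext (@FP_iter_add _ _ _ _ m (fun _ => 0) (fun a c => n a + c) p Hm
  (FP_const _ _ _) _ Pp _) _.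
- apply: FP_addn; last exact: FP_snd (FP_id _).
  exact: FP_comp Hn (FP_fst (FP_id _)).
- by move=> a c; have := Bp a; rewrite !csize_nat; lia.
- by move=> a; rewrite iter_addn_0 mulnC.
Qed.

Lemma FP_expn A (cA : codable A) (m : A -> nat) d : FP m -> FP (fun a => m a ^ d).
Proof.
move=> Hm; elim: d => [|d IHd]; first exact: FP_const.
by apply: FP_ext (FP_muln Hm IHd) _ => a; rewrite expnS.
Qed.

Lemma FP_behead A B (cA : codable A) (cB : codable B) (s : A -> seq B) :
  FP s -> FP (fun a => behead (s a)).
Proof.
move=> Hs; apply: FP_ext (FP_case Hs (FP_const _ _ [::]) (g := fun _ _ t => t) _) _.
  exact: FP_snd (FP_snd (FP_id _)).
by move=> a; case: (s a).
Qed.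

Lemma FP_head A B (cA : codable A) (cB : codable B) (x : A -> B) (s : A -> seq B) :
  FP x -> FP s -> FP (fun a => head (x a) (s a)).
Proof.
move=> Hx Hs; apply: FP_ext (FP_case Hs Hx (g := fun _ x _ => x) _) _ => //.
exact: FP_fst (FP_snd (FP_id _)).
Qed.

Lemma drop_iter T n (s : seq T) : drop n s = iter n behead s.
Proof. by elim: n s => [|n IHn] [|x s] //=; rewrite -iterS iterSr -?IHn //=; elim: n {IHn}. Qed.

Lemma FP_nth A B (cA : codable A) (cB : codable B) (x : A -> B) (s : A -> seq B)
    (n : A -> nat) : FP x -> FP s -> FP n -> FP (fun a => nth (x a) (s a) (n a)).
Proof.
move=> Hx Hs Hn; apply: FP_ext (FP_head Hx
  (@FP_iter_add _ _ _ _ n s (fun _ c => behead c) (fun _ => 0) Hn Hs _ _ _)) _.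
- exact: FP_behead (FP_snd (FP_id _)).
- exact: polyb_const.
- by move=> a [|x' c]; rewrite //= csize_cons; lia.
- by move=> a; rewrite -drop_iter -nth0 nth_drop addn0.
Qed.

Lemma FP_nseq A B (cA : codable A) (cB : codable B) (n : A -> nat) (x : A -> B) :
  FP n -> FP x -> FP (fun a => nseq (n a) (x a)).
Proof.
move=> Hn Hx; have [p Pp [_ Bp]] := FP_bound Hx.
apply: FP_ext (@FP_iter_add _ _ _ _ n (fun _ => [::]) (fun a c => x a :: c)
  (fun m => 2 * p m + 1) Hn (FP_const _ _ _) _ _ _) _.
- apply: FP_cons; last exact: FP_snd (FP_id _).
  exact: FP_comp Hx (FP_fst (FP_id _)).
- by polyb.
- by move=> a c; rewrite csize_cons; have := Bp a; lia.
- by move=> a; elim: (n a) => //= k ->.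
Qed.

Lemma FP_size A B (cA : codable A) (cB : codable B) (s : A -> seq B) :
  FP s -> FP (fun a => size (s a)).
Proof.
move=> Hs; apply: FP_ext (@FP_foldl _ _ _ _ _ _ s (fun _ => 0) (fun _ _ c => c.+1)
  (fun _ => 1) Hs (FP_const _ _ _) _ _ _) _.
- exact: FP_succ (FP_snd (FP_snd (FP_id _))).
- exact: polyb_const.
- by move=> a x c; rewrite !csize_nat addn1.
- move=> a; rewrite -[RHS]add0n; elim: (s a) 0 => [|x t IHt] n /=; first lia.
  by rewrite IHt; lia.
Qed.

Lemma FP_wsize A (cA : codable A) (w : A -> word) : FP w -> FP (fun a => size (w a)).
Proof.
move=> Hs; apply: FP_ext (@FP_wfoldl _ _ _ _ w (fun _ => 0) (fun _ _ c => c.+1)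
  (fun _ => 1) Hs (FP_const _ _ _) _ _ _) _.
- exact: FP_succ (FP_snd (FP_snd (FP_id _))).
- exact: polyb_const.
- by move=> a x c; rewrite !csize_nat addn1.
- move=> a; rewrite -[RHS]add0n; elim: (w a) 0 => [|x t IHt] n /=; first lia.
  by rewrite IHt; lia.
Qed.

Lemma FP_map A B C (cA : codable A) (cB : codable B) (cC : codable C)
    (h : A -> B -> C) (s : A -> seq B) :
  FP s -> FP (fun p : A * B => h p.1 p.2) -> FP (fun a => [seq h a x | x <- s a]).
Proof.
move=> Hs Hh; have [p Pp [Mp Bp]] := FP_bound Hh.
apply: FP_ext (FP_rev (@FP_foldl _ _ _ _ _ _ s (fun _ => [::])
  (fun a x c => h a x :: c) (fun n => 2 * p (2 * n + 1) + 1) Hs (FP_const _ _ _) _ _ _)) _.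
- apply: FP_cons; last exact: FP_snd (FP_snd (FP_id _)).
  apply: (FP_comp (f := fun t : A * (B * seq C) => (t.1, t.2.1)) Hh).
  exact: FP_pair (FP_fst (FP_id _)) (FP_fst (FP_snd (FP_id _))).
- by polyb; apply: (@polyb_comp p (fun n => 2 * n + 1)); polyb.
- move=> a x c; rewrite csize_cons; have := Bp (a, x); rewrite csize_pair /= => H.
  have := Mp (2 * csize cA a + 1 + csize cB x) (2 * (csize cA a + csize cB x) + 1) ltac:(lia).
  lia.
- move=> a; rewrite -[RHS](cat0s) -[[::] in RHS]/(rev [::]).
  elim: (s a) [::] => [|x t IHt] u /=; first by rewrite cats0.
  by rewrite IHt rev_cons cat_rcons.
Qed.

Lemma FP_wmap A C (cA : codable A) (cC : codable C) (h : A -> bool -> C) (w : A -> word) :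
  FP w -> FP (fun p : A * bool => h p.1 p.2) -> FP (fun a => [seq h a x | x <- w a]).
Proof.
move=> Hs Hh; have [p Pp [Mp Bp]] := FP_bound Hh.
apply: FP_ext (FP_rev (@FP_wfoldl _ _ _ _ w (fun _ => [::])
  (fun a x c => h a x :: c) (fun n => 2 * p (2 * n + 2) + 1) Hs (FP_const _ _ _) _ _ _)) _.
- apply: FP_cons; last exact: FP_snd (FP_snd (FP_id _)).
  apply: (FP_comp (f := fun t : A * (bool * seq C) => (t.1, t.2.1)) Hh).
  exact: FP_pair (FP_fst (FP_id _)) (FP_fst (FP_snd (FP_id _))).
- by polyb; apply: (@polyb_comp p (fun n => 2 * n + 2)); polyb.
- move=> a x c; rewrite csize_cons; have := Bp (a, x); rewrite csize_pair /= => H.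
  have := Mp (2 * csize cA a + 1 + csize code_bool x) (2 * csize cA a + 2); move: H.
  rewrite /(#[x]) /code /code_bool /=; lia.
- move=> a; rewrite -[RHS](cat0s) -[[::] in RHS]/(rev [::]).
  elim: (w a) [::] => [|x t IHt] u /=; first by rewrite cats0.
  by rewrite IHt rev_cons cat_rcons.
Qed.

Lemma flatten_foldl T (ss : seq (seq T)) : flatten ss = foldl (fun c s => c ++ s) [::] ss.
Proof.
rewrite -[LHS](cat0s); elim: ss [::] => [|s ss IHss] u /=; first by rewrite cats0.
by rewrite catA IHss.
Qed.

Lemma FP_flatten A B (cA : codable A) (cB : codable B) (ss : A -> seq (seq B)) :
  FP ss -> FP (fun a => flatten (ss a)).
Proof.
move=> Hs; apply: FP_ext (@FP_foldl _ _ _ _ _ _ ss (fun _ => [::]) (fun _ s c => c ++ s)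
  (fun n => n) Hs (FP_const _ _ _) _ _ _) _.
- exact: FP_cat (FP_snd (FP_snd (FP_id _))) (FP_fst (FP_snd (FP_id _))).
- exact: polyb_id.
- by move=> a x c; rewrite csize_cat; lia.
- by move=> a; rewrite flatten_foldl.
Qed.

Lemma FP_wflatten A (cA : codable A) (ss : A -> seq word) :
  FP ss -> FP (fun a => flatten (ss a)).
Proof.
move=> Hs; apply: FP_ext (@FP_foldl _ _ _ _ _ _ ss (fun _ => [::]) (fun _ s c => c ++ s)
  (fun n => n) Hs (FP_const _ _ _) _ _ _) _.
- exact: FP_wcat (FP_snd (FP_snd (FP_id _))) (FP_fst (FP_snd (FP_id _))).
- exact: polyb_id.
- by move=> a x c; rewrite /csize /code /code_word size_cat; lia.
- by move=> a; rewrite flatten_foldl.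
Qed.

Lemma FP_bits A B (cA : codable A) (cB : codable B) (h : A -> B -> bool) (s : A -> seq B) :
  FP s -> FP (fun p : A * B => h p.1 p.2) ->
  @FP _ _ _ code_word (fun a => [seq h a x | x <- s a]).
Proof.
move=> Hs Hh.
apply: FP_ext (FP_wflatten (FP_map (h := fun a x => [:: h a x]) Hs _)) _.
  exact: FP_wcons Hh (FP_const _ _ [::]).
by move=> a; elim: (s a) => //= x t ->.
Qed.

Lemma FP_all A B (cA : codable A) (cB : codable B) (h : A -> B -> bool) (s : A -> seq B) :
  FP s -> FP (fun p : A * B => h p.1 p.2) -> FP (fun a => all (fun x => h a x) (s a)).
Proof.
move=> Hs Hh; apply: FP_ext (@FP_foldl _ _ _ _ _ _ s (fun _ => true)
  (fun a x c => c && h a x) (fun n => 0) Hs (FP_const _ _ _) _ _ _) _.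
- apply: FP_andb; first exact: FP_snd (FP_snd (FP_id _)).
  apply: (FP_comp (f := fun t : A * (B * bool) => (t.1, t.2.1)) Hh).
  exact: FP_pair (FP_fst (FP_id _)) (FP_fst (FP_snd (FP_id _))).
- exact: polyb_const.
- by [].
- move=> a; rewrite -[RHS]andTb; elim: (s a) true => [|x t IHt] b /=.
    by rewrite andbT.
  by rewrite IHt andbA.
Qed.

Lemma FP_has A B (cA : codable A) (cB : codable B) (h : A -> B -> bool) (s : A -> seq B) :
  FP s -> FP (fun p : A * B => h p.1 p.2) -> FP (fun a => has (fun x => h a x) (s a)).
Proof.
move=> Hs Hh; apply: FP_ext (FP_negb (FP_all (h := fun a x => ~~ h a x) Hs (FP_negb Hh))) _ => a.
by rewrite -has_predC; apply: eq_has => x /=; rewrite negbK.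
Qed.

Lemma FP_filter A B (cA : codable A) (cB : codable B) (h : A -> B -> bool) (s : A -> seq B) :
  FP s -> FP (fun p : A * B => h p.1 p.2) -> FP (fun a => [seq x <- s a | h a x]).
Proof.
move=> Hs Hh; apply: FP_ext (FP_flatten (FP_map
  (h := fun a x => if h a x then [:: x] else [::]) Hs _)) _.
  apply: FP_if Hh _ (FP_const _ _ [::]).
  exact: FP_cons (FP_snd (FP_id _)) (FP_const _ _ [::]).
by move=> a; elim: (s a) => //= x t ->; case: (h a x).
Qed.

Lemma FP_eqw A (cA : codable A) (u v : A -> word) : FP u -> FP v ->
  FP (fun a => u a == v a).
Proof.
move=> Hu Hv.
(* The fold over [u] carries the verdict so far and the unread part of [v]; for equality nothing of
   [v] may be left at the end. *)
pose g (_ : A) (x : bool) (c : bool * word) : bool * word :=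
  if c.2 is y :: t then (c.1 && (x == y), t) else (false, [::]).
have Hg : FP (fun t : A * (bool * (bool * word)) => g t.1 t.2.1 t.2.2).
  apply: (@FP_wcase _ _ _ _ (fun t : A * (bool * (bool * word)) => t.2.2.2)
    (fun _ => (false, [::])) (fun t y u => (t.2.2.1 && (t.2.1 == y), u))).
  - exact: FP_snd (FP_snd (FP_snd (FP_id _))).
  - exact: FP_const.
  - apply: FP_pair; last exact: FP_snd (FP_snd (FP_id _)).
    apply: FP_andb; first exact: FP_fst (FP_snd (FP_snd (FP_fst (FP_id _)))).
    apply: FP_eqb; first exact: FP_fst (FP_snd (FP_fst (FP_id _))).
    exact: FP_fst (FP_snd (FP_id _)).
have HF := @FP_wfoldl _ _ _ _ u (fun a => (true, v a)) g (fun _ => 0) Hu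
  (FP_pair (FP_const _ _ _) Hv) Hg (polyb_const _).
have {}HF := HF _; apply: FP_ext (FP_andb (FP_fst (HF _))
  (FP_wcase (FP_snd (HF _)) (FP_const _ _ true) (g := fun _ _ _ => false) _)) _.
1,2: move=> a x [b [|y t]]; rewrite /g /= !csize_pair /csize /code /code_word /code_bool /=; lia.
  exact: FP_const.
move=> a.
have E (s t : word) b : let c := foldl (fun c x => g a x c) (b, t) s in
   c.1 && (if c.2 is _ :: _ then false else true) = b && (s == t).
  elim: s t b => [|x s IHs] [|y t] b //=.
  - have -> : foldl (fun c x => g a x c) (g a x (b, [::])) s = (false, [::]).
      by rewrite /g /=; elim: (s).
    by rewrite andbF.
  - by rewrite IHs /= eqseq_cons andbA.
exact: E.
Qed.

Lemma FP_iota A (cA : codable A) (n : A -> nat) : FP n -> FP (fun a => iota 0 (n a)).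
Proof.
move=> Hn; have [p Pp [_ Bp]] := FP_bound Hn.
(* For an arbitrary accumulator the growth of a round is not bounded in terms of [a], so the sizes
   are estimated on the lists that actually occur. *)
have E k : iter k (fun s => 0 :: map S s) [::] = iota 0 k.
  by elim: k => //= k ->; rewrite -[1]addn0 iotaDl.
apply: FP_ext (@FP_iter _ _ _ _ n (fun _ => [::]) (fun _ s => 0 :: [seq x.+1 | x <- s])
  (fun m => p m * (2 * p m + 1)) Hn (FP_const _ _ _) _ _ _) _ => [||a k le_k|a].
- apply: FP_cons; first exact: FP_const.
  exact: (FP_map (h := fun _ x => x.+1)) (FP_snd (FP_id _)) (FP_succ (FP_snd (FP_id _))).
- by polyb.
- rewrite E; have := Bp a; rewrite csize_nat => le_n.
  have H i : #[iota i k] <= k * (2 * (k + i) + 1).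
    elim: {le_k} k i => [|j IHj] i //=.
    by have := IHj i.+1; rewrite csize_cons csize_nat; nia.
  by apply: leq_trans (H 0) _; apply: leq_mul; lia.
- exact: E.
Qed.

Lemma FP_foldr_enc A B (cA : codable A) (cB : codable B) (e : B -> word)
    (s : A -> seq B) : FP e -> FP s -> FP (fun a => enc_seq e (s a)).
Proof.
move=> He Hs.
apply: FP_ext (FP_wcat (FP_wflatten (FP_map (h := fun _ x => true :: e x) Hs _))
  (FP_const _ _ [:: false])) _.
  exact: FP_wcons (FP_const _ _ _) (FP_comp He (FP_snd (FP_id _))).
by move=> a; rewrite /enc_seq; elim: (s a) => //= x t <-; rewrite -catA.
Qed.

Lemma FP_enc_word A (cA : codable A) (w : A -> word) : FP w -> FP (fun a => enc_word (w a)).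
Proof.
move=> Hw; apply: FP_recode (FP_pair Hw (FP_const _ _ ([::] : word))) _ => a.
exact: cats0.
Qed.

Lemma FP_eqn A (cA : codable A) (m n : A -> nat) : FP m -> FP n -> FP (fun a => m a == n a).
Proof.
move=> Hm Hn.
have Hm' : FP (fun a => code (m a)) by exact: Hm.
have Hn' : FP (fun a => code (n a)) by exact: Hn.
apply: FP_ext (FP_eqw Hm' Hn') _ => a.
apply/eqP/eqP => [/(congr1 size)|->] //.
by rewrite !size_nseq.
Qed.

Lemma FP_mem A (cA : codable A) (w : A -> word) (s : A -> seq word) :
  FP w -> FP s -> FP (fun a => w a \in s a).
Proof.
move=> Hw Hs; apply: FP_ext (FP_has (h := fun a x => w a == x) Hs _) _.
  exact: FP_eqw (FP_comp Hw (FP_fst (FP_id _))) (FP_snd (FP_id _)).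
by move=> a; elim: (s a) => //= x t ->; rewrite inE.
Qed.

(** A hook of [fp], redefined as further functions are shown to be computable. *)
Ltac fp_user := fail.
(** The variants for words precede those for lists, whose code is different. *)
Ltac fp_step := match goal with
  | |- FP fst => exact: FP_fst (FP_id _)
  | |- FP snd => exact: FP_snd (FP_id _)
  | |- @FP (seq bool) _ _ _ size => exact: FP_wsize (FP_id _)
  | |- FP (fun a => a) => apply: FP_id
  | |- FP (fun _ => ?b) => apply: FP_const
  | |- FP (fun _ => (_, _)) => apply: FP_pair
  | |- FP (fun _ => _ && _) => apply: FP_andb
  | |- FP (fun _ => _ || _) => apply: FP_orb
  | |- FP (fun _ => ~~ _) => apply: FP_negb
  | |- FP (fun _ => _ == _) => first [apply: FP_eqb | apply: FP_eqn | apply: FP_eqw]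
  | |- FP (fun _ => _ \in _) => apply: FP_mem
  | |- FP (fun _ => S _) => apply: FP_succ
  | |- FP (fun _ => addn _ _) => apply: FP_addn
  | |- FP (fun _ => muln _ _) => apply: FP_muln
  | |- FP (fun _ => expn _ _) => apply: FP_expn
  | |- FP (fun _ => nth _ _ _) => apply: FP_nth
  | |- FP (fun _ => @size bool _) => apply: FP_wsize
  | |- FP (fun _ => size _) => apply: FP_size
  | |- FP (fun _ => iota 0 _) => apply: FP_iota
  | |- FP (fun _ => nseq _ _) => apply: FP_nseq
  | |- @FP _ _ _ code_word (fun _ => map _ _) => apply: FP_bits
  | |- FP (fun _ => @map bool _ _ _) => apply: FP_wmap
  | |- FP (fun _ => map _ _) => apply: FP_map
  | |- FP (fun _ => @flatten bool _) => apply: FP_wflatten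
  | |- FP (fun _ => flatten _) => apply: FP_flatten
  | |- FP (fun _ => @cat bool _ _) => apply: FP_wcat
  | |- FP (fun _ => cat _ _) => apply: FP_cat
  | |- FP (fun _ => @cons bool _ _) => apply: FP_wcons
  | |- FP (fun _ => cons _ _) => apply: FP_cons
  | |- FP (fun _ => all _ _) => apply: FP_all
  | |- FP (fun _ => has _ _) => apply: FP_has
  | |- FP (fun _ => filter _ _) => apply: FP_filter
  | |- FP (fun _ => enc_word _) => apply: FP_enc_word
  | |- FP (fun _ => enc_seq _ _) => apply: FP_foldr_enc
  | |- FP (fun _ => if _ then _ else _) => apply: FP_if
  | |- FP (fun _ => fst _) => apply: FP_fst
  | |- FP (fun _ => snd _) => apply: FP_snd
  end.
Ltac fp := repeat first [assumption | fp_user | fp_step].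

(** * Membership in NP *)

Definition seq_nested (s t : seq word) : bool :=
  all (fun x => x \in t) s || all (fun x => x \in s) t.

Definition containment_matrix (l : seq (seq word)) : seq word :=
  [seq [seq (i != j) && seq_nested (nth [::] l i) (nth [::] l j)
         | j <- iota 0 (size l)] | i <- iota 0 (size l)].

(** The code of an instance as a function of the listings and the target bits alone, the adjacency
    matrix being forced by the sets. *)
Definition encode (l : seq (seq word)) (t : word) : word :=
  enc_seq enc_word (containment_matrix l) ++ enc_seq (enc_seq enc_word) l ++ enc_word t.

Lemma FP_seq_nested A (cA : codable A) (s t : A -> seq word) : FP s -> FP t ->
  FP (fun a => seq_nested (s a) (t a)).
Proof.
move=> Hs Ht.
have H : FP (fun p : seq word * seq word => seq_nested p.1 p.2) by rewrite /seq_nested; fp.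
exact: FP_comp H (FP_pair Hs Ht).
Qed.

Ltac fp_user ::= match goal with
  | |- FP (fun _ => seq_nested _ _) => apply: FP_seq_nested
  end.

Lemma FP_encode : FP (fun p : seq (seq word) * word => encode p.1 p.2).
Proof.
have He : FP enc_word by exact: FP_enc_word (FP_id _).
have Hee : FP (enc_seq enc_word) by exact: FP_foldr_enc He (FP_id _).
by rewrite /encode /containment_matrix; fp.
Qed.

Lemma nested_fset (s t : seq word) :
  nested [fset x in s]%fset [fset x in t]%fset = seq_nested s t.
Proof.
have H (u v : seq word) : ([fset x in u] `<=` [fset x in v])%fset = all (fun x => x \in v) u.
  apply/fsubsetP/allP => H x; first by move=> xu; have := H x; rewrite !inE; apply.
  by rewrite !inE; apply: H.
by rewrite /nested /seq_nested !H.
Qed.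

Lemma nested_fset_enum (X : {fset word}) (t : seq word) :
  nested X [fset x in t]%fset = seq_nested (enum_fset X) t.
Proof.
rewrite -nested_fset; congr nested; apply/fsetP => x.
by rewrite !inE.
Qed.

Lemma map_iota_ord n T (F : nat -> T) :
  [seq F i | i <- iota 0 n] = [seq F (val i) | i <- enum 'I_n].
Proof. by rewrite -val_enum_ord -map_comp. Qed.

(** Well-formedness determines the edges and the new set determines the target, so a positive
    instance amounts to the listings together with the new set. *)
Lemma ContainmentExtensionE w : ContainmentExtension w <->
  exists l X, all (fun x => x \in flatten l) X /\
    w = encode l [seq seq_nested X s | s <- l].
Proof.
split.
- move=> [I [-> [sym irr rep] [X sub ext]]].
  set l := [seq @listing I v | v <- enum 'I_(nvert I)].
  have sl : size l = nvert I by rewrite size_map size_enum_ord.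
  have nl (v : 'I_(nvert I)) : nth [::] l v = @listing I v.
    by rewrite (nth_map v) ?size_enum_ord // nth_ord_enum.
  exists l, (enum_fset X); split.
    apply/allP => x /(fsubsetP sub) /bigfcupP [v _]; rewrite /set_of inE => xv.
    by apply/flattenP; exists (@listing I v) => //; apply: map_f; rewrite mem_enum.
  rewrite /enc_instance /encode; congr (enc_seq _ _ ++ _ ++ enc_word _).
    rewrite /containment_matrix sl map_iota_ord; apply: eq_map => u.
    rewrite map_iota_ord; apply: eq_map => v; rewrite !nl -nested_fset.
    have [<-|ne] := eqVneq u v; first by rewrite eqxx irr.
    by rewrite val_eqE ne rep.
  rewrite /l -map_comp; apply: eq_map => v.
  by rewrite -ext /= nested_fset_enum.
- move=> [l [X [sub ->]]].
  pose n := size l.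
  pose I := @Instance n
    (fun u v : 'I_n => (val u != val v) && seq_nested (nth [::] l u) (nth [::] l v))
    (fun v => nth [::] l v)
    [set v : 'I_n | seq_nested X (nth [::] l v)].
  exists I; split.
  + rewrite /enc_instance /encode /containment_matrix -/n /= map_iota_ord.
    congr (_ ++ (_ ++ _)); congr (enc_seq _ _) || congr (enc_word _).
    * by apply: eq_map => u; rewrite map_iota_ord.
    * by rewrite -map_iota_ord map_nth_iota0 // take_size.
    * rewrite -{1}(mkseq_nth [::] l) /mkseq map_iota_ord -map_comp.
      by apply: eq_map => v; rewrite inE.
  + split.
    * by move=> u v; rewrite /= eq_sym /seq_nested orbC.
    * by move=> u; rewrite /= eqxx.
    * by move=> u v ne; rewrite /set_of nested_fset /= val_eqE ne.
  + exists [fset x in X]%fset.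
      apply/fsubsetP => x; rewrite inE => /(allP sub) /flattenP [s sl xs].
      have lt : index s l < n by rewrite index_mem.
      apply/bigfcupP; exists (Ordinal lt); first by rewrite mem_index_enum.
      by rewrite /set_of inE /= nth_index.
    by move=> v; rewrite /set_of nested_fset inE.
Qed.

(** * Certificates and their verification *)

Lemma FP_unpair1 A (cA : codable A) (w : A -> word) : FP w -> FP (fun a => (unpair (w a)).1).
Proof. by move=> Hw; exact: computable_comp Hw (computable_fst _). Qed.

Lemma FP_unpair2 A (cA : codable A) (w : A -> word) : FP w -> FP (fun a => (unpair (w a)).2).
Proof. by move=> Hw; exact: computable_comp Hw (computable_snd _). Qed.

Ltac fp_user ::= match goal with
  | |- FP (fun _ => seq_nested _ _) => apply: FP_seq_nested
  | |- FP (fun _ => fst (unpair _)) => apply: FP_unpair1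
  | |- FP (fun _ => snd (unpair _)) => apply: FP_unpair2
  end.

Definition decode_step (st : word * seq word) : word * seq word :=
  if st.1 is _ :: _ then ((unpair st.1).2, (unpair st.1).1 :: st.2) else st.

(** Total, so that every word is a certificate. *)
Definition decode_words (w : word) : seq word :=
  rev (iter (size w) decode_step (w, [::])).2.

(** The code is at least as long as the list, so there are enough rounds, and rounds on the empty
    word do nothing. *)
Lemma decode_wordsK (s : seq word) : decode_words (code s) = s.
Proof.
have H k u : size s <= k -> iter k decode_step (code s, u) = ([::], catrev s u).
  elim: s k u => [|x s IHs] [|k] u //= le_k.
    by elim: k {le_k} => //= k ->.
  rewrite -iterS iterSr -(IHs k (x :: u)) //; congr (iter k _ _).
  have : code (x :: s) != [::].
    by rewrite -size_eq0 -[size _]/(csize _ (x :: s)) csize_cons; lia.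
  rewrite /decode_step -[code (x :: s)]/(enc_pair (code x) (code s)) /=.
  by case E: (enc_pair _ _) => [|b w] // _; rewrite -E enc_pairK.
by rewrite /decode_words H ?size_csize // /= -[catrev _ _]/(rev s) revK.
Qed.

Lemma FP_decode_words A (cA : codable A) (w : A -> word) : FP w ->
  FP (fun a => decode_words (w a)).
Proof.
move=> Hw.
have Hstep : FP decode_step.
  apply: (@FP_wcase _ _ _ _ (fun st : word * seq word => st.1) (fun st => st)
    (fun st _ _ => ((unpair st.1).2, (unpair st.1).1 :: st.2))); fp.
apply: FP_rev; apply: FP_snd.
apply: (@FP_iter_add _ _ _ _ (fun a => size (w a)) (fun a => (w a, [::]))
  (fun _ => decode_step) (fun _ => 1)).
- by fp.
- by fp.
- exact: FP_comp Hstep (FP_snd (FP_id _)).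
- exact: polyb_const.
- move=> _ [[|b u] s] /=; first by rewrite leq_addr.
  have := size_unpair (b :: u); rewrite /decode_step !csize_pair csize_cons.
  by move: (unpair _) => [x y]; rewrite /csize /code /code_word /=; lia.
Qed.

Lemma FP_poly_time_pred (p : pred word) : FP p -> poly_time_pred p.
Proof. exact: computable_poly_time. Qed.

Lemma size_enc_seq T (e : T -> word) s :
  size (enc_seq e s) = sumn [seq (size (e x)).+1 | x <- s] + 1.
Proof. by rewrite /enc_seq; elim: s => //= x s IHs; rewrite size_cat IHs; lia. Qed.

Lemma csize_sumn A (cA : codable A) (s : seq A) :
  #[s] = sumn [seq 2 * #[x] + 1 | x <- s].
Proof. by elim: s => //= x s IHs; rewrite csize_cons IHs; lia. Qed.

Lemma leq_sumn (T : Type) (F G : T -> nat) s : (forall x, F x <= G x) ->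
  sumn [seq F x | x <- s] <= sumn [seq G x | x <- s].
Proof. by move=> H; elim: s => //= x s IHs; apply: leq_add. Qed.

Lemma csize_enc_words (s : seq word) : #[s] <= size (enc_seq enc_word s).
Proof.
rewrite csize_sumn size_enc_seq; apply: leq_trans (leq_addr _ _).
by apply: leq_sumn => x; rewrite size_enc_word /csize /code /code_word; lia.
Qed.

(** Bounds the listings in the certificate by their copy in the instance; the factor 2 pays for the
    extra level of pairing. *)
Lemma csize_listing (l : seq (seq word)) :
  #[[seq code s : word | s <- l]] <= 2 * size (enc_seq (enc_seq enc_word) l).
Proof.
have H (s : seq word) : csize code_word (code s) <= size (enc_seq enc_word s).
  exact: csize_enc_words.
rewrite size_enc_seq; elim: l => //= s l IHl.
by rewrite csize_cons; have := H s; move: IHl; lia.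
Qed.

Lemma csize_flatten A (cA : codable A) (l : seq (seq A)) : 
  #[flatten l] = sumn [seq #[s] | s <- l].
Proof. by elim: l => //= s l IHl; rewrite csize_cat IHl. Qed.

Lemma csize_filter A (cA : codable A) (p : pred A) (s : seq A) :
  #[[seq x <- s | p x]] <= #[s].
Proof. by elim: s => //= x s IHs; case: (p x); rewrite ?csize_cons; lia. Qed.

Theorem ContainmentExtension_NP : NP ContainmentExtension.
Proof.
pose V (w : word) :=
  let x := (unpair w).1 in
  let l := [seq decode_words s | s <- decode_words (unpair (unpair w).2).1] in
  let X := decode_words (unpair (unpair w).2).2 in
  all (fun x => x \in flatten l) X && (x == encode l [seq seq_nested X s | s <- l]).
exists V.
  apply: FP_poly_time_pred.
  have HX : FP (fun w : word => decode_words (unpair (unpair w).2).2).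
    by apply: FP_decode_words; fp.
  have Hl : FP (fun w : word =>
      [seq decode_words s | s <- decode_words (unpair (unpair w).2).1]).
    apply: FP_map; last by apply: FP_decode_words; fp.
    by apply: FP_decode_words; fp.
  have H : FP (fun p : word * (seq (seq word) * seq word) =>
      all (fun x => x \in flatten p.2.1) p.2.2 &&
      (p.1 == encode p.2.1 [seq seq_nested p.2.2 s | s <- p.2.1])).
    apply: FP_andb; first by fp.
    apply: FP_eqw; first by fp.
    apply: (FP_comp (f := fun p : word * (seq (seq word) * seq word) =>
      (p.2.1, [seq seq_nested p.2.2 s | s <- p.2.1] : word)) FP_encode).
    by fp.
  have Hw : FP (fun w : word => (unpair w).1) by fp.
  exact: FP_comp H (FP_pair Hw (FP_pair Hl HX)).
(* The listings cost at most four times the size of the instance, a factor 2 for their code and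
   another for the pairing, and the new set costs at most once that size. *)
exists 5, 1 => x; rewrite ContainmentExtensionE; split; last first.
  move=> [y _]; rewrite /V enc_pairK /= => /andP [HX /eqP ->].
  by do 2!eexists; split; first exact: HX.
move=> [l [X [HX ->]]]; set x' := encode _ _.
(* The list [X] may repeat its elements without bound; [Y] has the same members and is no longer
   than the listings. *)
pose Y := [seq u <- flatten l | u \in X].
have HY : Y =i X.
  move=> u; rewrite mem_filter; case uX: (u \in X) => //=.
  exact: (allP HX).
have nestedY s : seq_nested Y s = seq_nested X s.
  by rewrite /seq_nested (eq_all_r HY); congr orb; apply: eq_all => u; rewrite HY.
exists (enc_pair (code [seq code s : word | s <- l]) (code Y)).
  rewrite expn1 size_enc_pair.
  have := csize_listing l; have := csize_filter code_word (fun u => u \in X) (flatten l).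
  rewrite csize_flatten /x' /encode !size_cat -/(csize _ _) => H1 H2.
  have H3 : sumn [seq #[s] | s <- l] <= size (enc_seq (enc_seq enc_word) l).
    rewrite size_enc_seq; apply: leq_trans (leq_addr _ _).
    by apply: leq_sumn => s; apply: leq_trans (csize_enc_words s) _.
  apply: leq_trans (leq_add (leq_add (leq_mul (leqnn 2) H2) (leqnn 1)) (leq_trans H1 H3)) _.
  lia.
rewrite /V enc_pairK /= enc_pairK /= !decode_wordsK -map_comp.
have -> : [seq (decode_words \o code) s | s <- l] = l.
  by rewrite -[RHS]map_id; apply: eq_map => s; apply: decode_wordsK.
rewrite (eq_all_r HY) HX /= /x'; apply/eqP; congr encode.
by apply: eq_map => s; rewrite nestedY.
Qed.

(** * Constraint satisfaction as containment extension *)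

Lemma seq_nestedPn (X s : seq word) :
  reflect ((exists2 x, x \in X & x \notin s) /\ (exists2 x, x \in s & x \notin X))
    (~~ seq_nested X s).
Proof.
rewrite /seq_nested negb_or.
apply: (iffP andP) => -[].
  by move=> /allPn [x xX xs] /allPn [y ys yX]; split; [exists x | exists y].
by move=> [x xX xs] [y ys yX]; split; apply/allPn; [exists x | exists y].
Qed.

Definition incomparable_exists (l : seq (seq word)) : Prop :=
  exists2 X : seq word, {subset X <= flatten l} & forall s, s \in l -> ~~ seq_nested X s.

Section HittingToContainment.

Variables (covers forbids : seq (seq word)) (d e : word).

Definition universe := [:: d, e & flatten covers].

(** Incomparability with [[:: d]] and [universe] minus [e] forces [d] out of and
    [e] into the new set; these two elements take care of one of the two
    non-inclusions for every other set. *)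
Definition gadget : seq (seq word) :=
  [:: [:: d], [seq u <- universe | u != e]
    & [seq [seq u <- universe | u \notin c] | c <- covers] ++ forbids].

Hypotheses (de : d != e) (dU : d \notin flatten covers) (eU : e \notin flatten covers).
Hypotheses (covers_nonempty : covers != [::])
  (forbidsU : forall f, f \in forbids -> {subset f <= flatten covers}).

(** From left to right the new set is restricted to the covered elements. From right to left [e] is
    added: it witnesses that the new set is not inside a forbidden set, and [d] that no complement
    of a cover is inside the new set. *)
Lemma gadgetP : incomparable_exists gadget <->
  exists X : seq word, [/\ {subset X <= flatten covers},
    forall c, c \in covers -> exists2 u, u \in c & u \in X &
    forall f, f \in forbids -> exists2 u, u \in f & u \notin X].
Proof.
have in_cover c u : c \in covers -> u \in c -> u \in flatten covers.
  by move=> cC uc; apply/flattenP; exists c.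
have gadget_cover c : c \in covers -> [seq u <- universe | u \notin c] \in gadget.
  move=> cC; rewrite !inE mem_cat; apply/or4P; constructor 3.
  by apply/mapP; exists c.
have gadget_forbid f : f \in forbids -> f \in gadget.
  by move=> fF; rewrite !inE mem_cat fF !orbT.
split.
- move=> [X XU HX].
  have sub u : u \in X -> u \in universe.
    move=> /XU /flattenP [s]; rewrite !inE mem_cat => /or4P [/eqP ->|/eqP ->|/mapP [c _ ->]|fF].
    + by rewrite inE => /eqP ->; rewrite eqxx.
    + by rewrite mem_filter => /andP [].
    + by rewrite mem_filter => /andP [].
    + by move=> /(forbidsU fF) ->; rewrite !orbT.
  have dX : d \notin X.
    by have /seq_nestedPn [_ [u]] := HX [:: d] (mem_head _ _); rewrite inE => /eqP ->.
  exists [seq u <- X | u \in flatten covers]; split.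
  + by move=> u; rewrite mem_filter => /andP [].
  + move=> c cC; have /seq_nestedPn [[u uX uc] _] := HX _ (gadget_cover _ cC).
    rewrite mem_filter (sub _ uX) andbT negbK in uc.
    by exists u => //; rewrite mem_filter uX (in_cover c).
  + move=> f fF; have /seq_nestedPn [_ [u uf uX]] := HX _ (gadget_forbid _ fF).
    by exists u; rewrite // mem_filter (negPf uX) andbF.
- move=> [X [XU Xc Xf]].
  have dX : d \notin X by apply: contra dU => /XU.
  have dX' : d \notin e :: X by rewrite inE negb_or de.
  have dUn : d \in universe by exact: mem_head.
  exists (e :: X).
    move=> u; rewrite inE => /predU1P [->|uX].
      (* The element [e] must occur in a listed set; it lies in the complement of any cover. *)
      case: covers covers_nonempty in_cover gadget_cover eU => // c cs _ _ G eU'.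
      apply/flattenP; eexists; first exact: (G c (mem_head _ _)).
      rewrite mem_filter /universe !inE eqxx orbT andbT.
      by apply: contra eU' => ec; rewrite /= mem_cat ec.
    apply/flattenP; exists [seq u <- universe | u != e]; first by rewrite !inE eqxx orbT.
    rewrite mem_filter /universe !inE (XU _ uX) !orbT andbT.
    by apply: contra eU => /eqP <-; apply: XU.
  move=> s; rewrite !inE mem_cat => /or4P [/eqP ->|/eqP ->|/mapP [c cC ->]|fF]; apply/seq_nestedPn.
  + split; last by exists d; rewrite ?mem_head.
    by exists e; rewrite ?mem_head // inE eq_sym.
  + split; first by exists e; rewrite ?mem_head // mem_filter eqxx.
    by exists d => //; rewrite mem_filter de dUn.
  + split.
      have [u uc uX] := Xc c cC; exists u; first by rewrite inE uX orbT.
      by rewrite mem_filter uc.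
    exists d => //; rewrite mem_filter dUn andbT.
    by apply: contra dU; apply: in_cover.
  + split.
      exists e; first exact: mem_head.
      by apply: contra eU; apply: forbidsU.
    have [u us uX] := Xf _ fF; exists u => //; rewrite inE negb_or uX andbT.
    by apply: contra eU => /eqP <-; apply: forbidsU us.
Qed.

End HittingToContainment.

(** For a fixed finite type these codes have bounded length. *)
Instance code_fin (T : finType) : codable T | 20 := fun x => nseq (enum_rank x) true.

Lemma code_nat_inj : injective (code : nat -> word).
Proof. by move=> m n /(congr1 size); rewrite !size_nseq. Qed.

Lemma code_fin_inj (T : finType) : injective (@code T (@code_fin T)).
Proof.
by move=> x y /(congr1 size); rewrite !size_nseq => /ord_inj /enum_rank_inj.
Qed.

Lemma code_pair_inj A B (cA : codable A) (cB : codable B) :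
  injective (@code A cA) -> injective (@code B cB) ->
  injective (@code (A * B) (code_prod cA cB)).
Proof.
move=> IA IB [x y] [x' y'] /(congr1 unpair).
by rewrite !enc_pairK => -[/IA -> /IB ->].
Qed.

(** * Slots, values and forbidden combinations as a family of sets *)

Section CSP.

Variables (Sig : finType).

(** A literal says that the slot in row [p.1], column [p.2.1] holds [p.2.2]. *)
Notation literal := (nat * (nat * Sig))%type.

(** The leading [true] keeps names apart from [[::]] and [[:: false]], which play the roles of [d]
    and [e]. *)
Definition name (p : literal) : word := true :: code p.

Lemma name_inj : injective name.
Proof.
move=> p q [] /code_pair_inj; apply; first exact: code_nat_inj.
by apply: code_pair_inj; [exact: code_nat_inj | exact: code_fin_inj].
Qed.

Definition cover (t j : nat) : seq word := [seq name (t, (j, v)) | v <- enum Sig].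

Definition csp_sets (h w : nat) (F : seq (seq literal)) : seq (seq word) :=
  gadget [seq cover t j | t <- iota 0 h, j <- iota 0 w] [seq [seq name p | p <- f] | f <- F]
    [::] [:: false].

Lemma csp_setsP h w (F : seq (seq literal)) : 0 < h -> 0 < w ->
  (forall f, f \in F -> forall p, p \in f -> p.1 < h /\ p.2.1 < w) ->
  incomparable_exists (csp_sets h w F) <->
  exists a : nat -> nat -> Sig, forall f, f \in F -> exists2 p, p \in f & a p.1 p.2.1 != p.2.2.
Proof.
move=> h0 w0 HF; set covers := [seq cover t j | t <- iota 0 h, j <- iota 0 w].
have coversP c : reflect (exists t j, [/\ t < h, j < w & c = cover t j]) (c \in covers).
  apply: (iffP allpairsP) => [[[t j] /= []]|[t [j [lt lj ->]]]].
    by rewrite !mem_iota => lt lj ->; exists t, j.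
  by exists (t, j); rewrite !mem_iota.
have in_covers t j v : t < h -> j < w -> name (t, (j, v)) \in flatten covers.
  move=> lt lj; apply/flattenP; exists (cover t j); first by apply/coversP; exists t, j.
  by apply/mapP; exists v; rewrite ?mem_enum.
have notin u : ohead u <> Some true -> u \notin flatten covers.
  move=> Hu; apply/negP => /flattenP [c /coversP [t [j [_ _ ->]]] /mapP [v _ E]].
  by rewrite E in Hu.
rewrite /csp_sets gadgetP //; try exact: notin; last first.
- move=> f /mapP [f' fF ->] u /mapP [[t [j v]] pf ->].
  by have [lt lj] := HF _ fF _ pf; apply: in_covers.
- rewrite -size_eq0 size_allpairs !size_iota; lia.
split.
- move=> [X [_ Xc Xf]].
  have Xv t j : t < h -> j < w -> exists v, name (t, (j, v)) \in X.
    move=> lt lj; have [|u /mapP [v _ ->] uX] := Xc (cover t j); last by exists v.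
    by apply/coversP; exists t, j.
  have [v0 _] := Xv 0 0 h0 w0.
  (* Inside the grid the choice never falls back on [v0], as [X] meets every cover; the default only
     fills the slots outside. It exists because the grid has a slot. *)
  exists (fun t j => odflt v0 [pick v | name (t, (j, v)) \in X]) => f fF.
  have [u /mapP [[t [j v]] pf ->] uX] := Xf _ (map_f (map name) fF).
  exists (t, (j, v)) => //=; have /= [lt lj] := HF _ fF _ pf.
  case: pickP => [v' v'X|no] /=.
    by apply: contraNneq uX => <-.
  by have [v' v'X] := Xv _ _ lt lj; rewrite no in v'X.
- move=> [a Ha]; exists [seq name (t, (j, a t j)) | t <- iota 0 h, j <- iota 0 w]; split.
  + move=> u /allpairsP [[t j] /= []]; rewrite !mem_iota => lt lj ->.
    exact: in_covers.
  + move=> c /coversP [t [j [lt lj ->]]]; exists (name (t, (j, a t j))).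
      by apply: map_f; rewrite mem_enum.
    by apply/allpairsP; exists (t, j); rewrite !mem_iota.
  + move=> f /mapP [f' fF ->]; have [[t [j v]] pf /= ne] := Ha _ fF.
    exists (name (t, (j, v))); first exact: map_f.
    apply/negP => /allpairsP [[t' j'] /= [_ _ /name_inj [Et Ej Ev]]].
    by rewrite Ev Et Ej eqxx in ne.
Qed.

End CSP.

Lemma FP_csp_sets (Sig : finType) A (cA : codable A) (h w : A -> nat)
    (F : A -> seq (seq (nat * (nat * Sig)))) :
  FP h -> FP w -> FP F -> FP (fun a => csp_sets (h a) (w a) (F a)).
Proof.
move=> Hh Hw HF.
have Hname : FP (@name Sig).
  by apply: (FP_wcons (FP_const _ _ true)); exact: (@FP_id (nat * (nat * Sig)) _).
have Hcover : FP (fun p : nat * nat => cover Sig p.1 p.2).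
  by apply: FP_map; [fp | apply: (FP_comp Hname); fp].
have Hcovers : FP (fun a => [seq cover Sig t j | t <- iota 0 (h a), j <- iota 0 (w a)]).
  apply: FP_flatten; apply: FP_map; first by fp.
  apply: FP_map; first by apply: FP_iota; apply: (FP_comp Hw); fp.
  by apply: (FP_comp (f := fun p : (A * nat) * nat => (p.1.2, p.2)) Hcover); fp.
have Hforbids : FP (fun a => [seq [seq name p | p <- f] | f <- F a]).
  by apply: FP_map => //; apply: FP_map; [fp | apply: (FP_comp Hname); fp].
have Hgadget : FP (fun p : seq (seq word) * seq (seq word) =>
    gadget p.1 p.2 [::] [:: false]).
  by rewrite /gadget /universe; fp.
exact: FP_comp Hgadget (FP_pair Hcovers Hforbids).
Qed.

(** * Unique decoding of instances, and the case of an empty target *)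

Definition prefix_code T (e : T -> word) : Prop :=
  forall x y u v, e x ++ u = e y ++ v -> x = y /\ u = v.

Lemma prefix_code_enc_seq T (e : T -> word) : prefix_code e -> prefix_code (enc_seq e).
Proof.
move=> He; elim=> [|x s IHs] [|y t] u v //=; first by move=> [].
by rewrite -!catA => -[/He [-> /IHs [-> ->]]].
Qed.

Lemma prefix_code_enc_word : prefix_code enc_word.
Proof. by apply: prefix_code_enc_seq => x y u v [-> ->]. Qed.

(** The three components are concatenated without separators; the split is unique because they are
    prefix codes. *)
Lemma encode_inj l l' t t' : encode l t = encode l' t' -> l = l' /\ t = t'.
Proof.
move=> /(prefix_code_enc_seq prefix_code_enc_word) [_].
move=> /(prefix_code_enc_seq (prefix_code_enc_seq prefix_code_enc_word)) [-> E].
by split => //; have := @prefix_code_enc_word t t' [::] [::]; rewrite !cats0 => /(_ E) [].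
Qed.

Lemma incomparable_ContainmentExtension l :
  incomparable_exists l <-> ContainmentExtension (encode l (nseq (size l) false)).
Proof.
rewrite ContainmentExtensionE; split.
- move=> [X XU HX]; exists l, X; split; first exact/allP.
  congr encode; elim: l HX {XU} => //= s l IHl HX.
  rewrite (negPf (HX s (mem_head _ _))) IHl // => s' s'l.
  by apply: HX; rewrite inE s'l orbT.
- move=> [l' [X [XU /encode_inj [E1 E]]]]; rewrite -{}E1 in XU E.
  exists X; first exact/allP.
  move=> s sl; apply/negbT.
  have : seq_nested X s \in nseq (size l) false.
    by rewrite E; apply/mapP; exists s.
  by rewrite mem_nseq => /andP [_ /eqP].
Qed.

(** * Tableaux *)

Section Tableau.

Variable M : TM.
Notation G := (symbol M).
Notation K := (extra_tapes M).

(** Whether the slot is the scanned one, the current state, and the content of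
    every tape at the same offset from its own head. *)
Definition slot : finType :=
  (bool * state M * {ffun 'I_K.+1 -> option (bool + G)})%type.

(** Otherwise [slot] is unfolded, and coded as a product. *)
#[local] Instance code_slot : codable slot | 0 := @code_fin slot.

Definition slot_flag (v : slot) : bool := v.1.1.
Definition slot_state (v : slot) : state M := v.1.2.
Definition slot_cell (v : slot) (i : 'I_K.+1) : cell G := v.2 i.

(** Column [R] holds the scanned cells. *)
Definition tape_cell (R : nat) (t : tape G) (j : nat) : cell G :=
  if j < R then nth None (tape_left t) (R - j.+1)
  else nth None (tape_head t :: tape_right t) (j - R).

Definition view (R : nat) (c : config M) (j : nat) : slot :=
  (j == R, cstate c, [ffun i => tape_cell R (ctapes c i) j]).

(** Here [b] is the old slot of the same column, [a] and [c] are its neighbours, and [h] is the slot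
    of the head column, which supplies the state and all scanned symbols. A head moving left shifts
    its tape to the right, so the content comes from [a]. *)
Definition next_slot (a b c h : slot) : slot :=
  if halting (slot_state h) then b else
  let: (q, act) := trans (slot_state h) h.2 in
  let written (v : slot) i := if slot_flag v then (act i).1 else slot_cell v i in
  (slot_flag b, q, [ffun i => match (act i).2 with
                              | MoveLeft => written a i
                              | Stay => written b i
                              | MoveRight => written c i
                              end]).

(** Stated for column [j.+1], so that the left neighbour is column [j] and no truncated subtraction
    occurs. *)
Lemma tape_cell_shift R t d (x : cell G) j :
  let w k := if k == R then x else tape_cell R t k in
  tape_cell R (shift d (write x t)) j.+1 =
  match d with MoveLeft => w j | Stay => w j.+1 | MoveRight => w j.+2 end.
Proof.
rewrite /=; case: t d => l h r [] /=; rewrite /tape_cell /=.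
- case: (ltngtP j R) => [lt_jR|lt_Rj|<-].
  + case: (ltnP j.+1 R) => [lt_SjR|le_RSj].
      by rewrite nth_behead; congr nth; lia.
    have -> : j.+1 - R = 0 by lia.
    have -> : R - j.+1 = 0 by lia.
    by rewrite /= nth0.
  + have -> : j.+1 < R = false by lia.
    by rewrite subSn //= ?[in RHS]leqNgt; [case E: (j - R) => [|k] //=; lia | lia].
  + have -> : j.+1 < j = false by lia.
    by rewrite subSnn.
- case: (ltngtP j.+1 R) => [lt|gt|<-] //.
    by case E: (j.+1 - R) => [|k] //=; lia.
  by rewrite subnn.
- case: (ltngtP j.+2 R) => [lt|gt|E].
  + by have -> : R - j.+2 = (R - j.+3).+1 by lia.
  + have -> : j.+2 - R = (j.+1 - R).+1 by lia.
    by case: (j.+1 - R) => [|k] /=; rewrite ?nth0 // nth_behead.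
  + by have -> : R - j.+2 = 0 by lia.
Qed.

Lemma view_step R c j :
  view R (step c) j.+1 =
  next_slot (view R c j) (view R c j.+1) (view R c j.+2) (view R c R).
Proof.
rewrite /next_slot /slot_state /= /step; case: ifP => // _.
have -> : [ffun i => tape_cell R (ctapes c i) R] = [ffun i => tape_head (ctapes c i)].
  by apply/ffunP => i; rewrite !ffunE /tape_cell ltnn subnn.
case: (trans _ _) => q act; rewrite /view /=; congr (_, _, _).
apply/ffunP => i; rewrite !ffunE tape_cell_shift /slot_flag /slot_cell /=.
by case: (act i).2; rewrite ffunE.
Qed.

(** What the verifier's input tape holds in a column: a known cell, or an unknown
    bit of the certificate (possibly past its end). *)
Definition fits (k : option (option bool)) (c : cell G) : bool :=
  match k with
  | Some None => c == None
  | Some (Some b) => c == Some (inl b)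
  | None => if c is Some (inr _) then false else true
  end.

Definition initial_slot (k : option (option bool)) (v : slot) : bool :=
  [&& slot_state v == start M, fits k (slot_cell v ord0)
    & [forall i, (i != ord0) ==> (slot_cell v i == None)]].

Definition disallowed (k : option (option bool)) : seq slot :=
  [seq v <- enum slot | ~~ initial_slot k v].

Definition illegal_windows : seq (slot * (slot * (slot * (slot * slot)))) :=
  [seq p <- enum {: slot * (slot * (slot * (slot * slot)))} |
    p.2.2.2.2 != next_slot p.1 p.2.1 p.2.2.1 p.2.2.2.1].

(** Forbidding these neighbours makes the unknown part of the input tape a word followed by blanks,
    without gaps. *)
Definition resumptions : seq (slot * slot) :=
  [seq p <- enum {: slot * slot} |
    (slot_cell p.1 ord0 == None) && (slot_cell p.2 ord0 != None)].

Definition rejecting : seq slot :=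
  [seq v <- enum slot | slot_cell v ord0 != Some (inl true)].

Definition flagged (b : bool) : seq slot := [seq v <- enum slot | slot_flag v == b].

(** There are [T] blank columns to the left of the input, [2 * size x + 1] for the code of [x], [B]
    for the certificate and [T + 1] more. The form with two successors makes the windows [j],
    [j.+1], [j.+2] fit. *)
Definition columns (x : word) (B T : nat) : nat := (T + (2 * size x) + B + T).+2.

(** Written with constant lists only, which makes it visibly computable; [first_rowE] recovers the
    uniform description by kinds of columns. *)
Definition first_row (x : word) (B T : nat) : seq (seq slot) :=
  nseq T (disallowed (Some None))
  ++ [seq if b then disallowed (Some (Some true)) else disallowed (Some (Some false))
       | b <- enc_word x]
  ++ nseq B (disallowed None) ++ nseq T.+1 (disallowed (Some None)).

Notation literal := (nat * (nat * slot))%type.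

Definition tableau (x : word) (B T : nat) : seq (seq literal) :=
  [seq [:: (0, (j, v))] | j <- iota 0 (columns x B T), v <- nth [::] (first_row x B T) j]
  ++ [seq [:: (0, (j, v))] | j <- iota 0 (columns x B T), v <- flagged (~~ (j == T))]
  ++ [seq [:: (0, (T + size (enc_word x) + j, p.1)); (0, ((T + size (enc_word x) + j).+1, p.2))]
       | j <- iota 0 B, p <- resumptions]
  ++ [seq [:: (q.1, (q.2, p.1)); (q.1, (q.2.+1, p.2.1)); (q.1, (q.2.+2, p.2.2.1));
              (q.1, (T, p.2.2.2.1)); (q.1.+1, (q.2.+1, p.2.2.2.2))]
       | q <- [seq (t, j) | t <- iota 0 T, j <- iota 0 (T + (2 * size x) + B + T)],
         p <- illegal_windows]
  ++ [seq [:: (T, (T, v))] | v <- rejecting].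

Lemma FP_tableau A (cA : codable A) (x : A -> word) (B T : A -> nat) :
  FP x -> FP B -> FP T -> FP (fun a => tableau (x a) (B a) (T a)).
Proof.
move=> Hx HB HT.
have Hflag : FP flagged.
  by apply: FP_ext (FP_if (FP_id _) (FP_const _ _ _) (FP_const _ _ _)) _ => -[].
have H : FP (fun p : word * (nat * nat) => tableau p.1 p.2.1 p.2.2).
  rewrite /tableau /first_row /columns; fp.
  by apply: (FP_comp Hflag); fp.
exact: FP_comp H (FP_pair Hx (FP_pair HB HT)).
Qed.

Definition satisfies (a : nat -> nat -> slot) (F : seq (seq literal)) : Prop :=
  forall f, f \in F -> exists2 p, p \in f & a p.1 p.2.1 != p.2.2.

Lemma satisfies_cat a F1 F2 : satisfies a (F1 ++ F2) <-> satisfies a F1 /\ satisfies a F2.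
Proof.
split=> [H|[H1 H2] f]; first by split=> f fF; apply: H; rewrite mem_cat fF ?orbT.
by rewrite mem_cat => /orP [/H1|/H2].
Qed.

Lemma satisfies_cat5 a F1 F2 F3 F4 F5 : satisfies a (F1 ++ F2 ++ F3 ++ F4 ++ F5) <->
  [/\ satisfies a F1, satisfies a F2, satisfies a F3, satisfies a F4 & satisfies a F5].
Proof. by rewrite !satisfies_cat; split=> [[? [? [? []]]]|[]]. Qed.

Definition column_kinds (x : word) (B T : nat) : seq (option (option bool)) :=
  nseq T (Some None) ++ [seq Some (Some b) | b <- enc_word x]
  ++ nseq B None ++ nseq T.+1 (Some None).

Lemma first_rowE x B T : first_row x B T = [seq disallowed k | k <- column_kinds x B T].
Proof.
rewrite /first_row /column_kinds !map_cat !map_nseq -map_comp.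
by congr (_ ++ (_ ++ _)); apply: eq_map => -[].
Qed.

Lemma size_column_kinds x B T : size (column_kinds x B T) = columns x B T.
Proof.
rewrite /column_kinds /columns !size_cat !size_nseq size_map size_enc_word; lia.
Qed.

Record valid_tableau x B T (a : nat -> nat -> slot) : Prop := ValidTableau {
  valid_first : forall j, j < columns x B T ->
    initial_slot (nth (Some None) (column_kinds x B T) j) (a 0 j);
  valid_flag : forall j, j < columns x B T -> slot_flag (a 0 j) = (j == T);
  valid_certificate : forall k, k < B ->
    slot_cell (a 0 (T + size (enc_word x) + k)) ord0 = None ->
    slot_cell (a 0 (T + size (enc_word x) + k).+1) ord0 = None;
  valid_step : forall t j, t < T -> j < T + (2 * size x) + B + T ->
    a t.+1 j.+1 = next_slot (a t j) (a t j.+1) (a t j.+2) (a t T);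
  valid_accept : slot_cell (a T T) ord0 = Some (inl true) }.

(** A failure of one of the five conditions is exactly a forbidden combination all of whose literals
    hold. *)
Lemma satisfies_tableau x B T a : satisfies a (tableau x B T) <-> valid_tableau x B T a.
Proof.
rewrite /tableau satisfies_cat5; split.
- move=> [H1 H2 H3 H4 H5]; split.
  + move=> j lt_j; apply/negPn/negP => no.
    have [|p] := H1 [:: (0, (j, a 0 j))].
      apply/allpairsPdep; exists j, (a 0 j); rewrite mem_iota lt_j first_rowE; split => //.
      by rewrite (nth_map (Some None)) ?size_column_kinds // mem_filter no mem_enum.
    by rewrite inE => /eqP -> /=; rewrite eqxx.
  + move=> j lt_j; apply/eqP/negPn/negP => no.
    have [|p] := H2 [:: (0, (j, a 0 j))].
      apply/allpairsPdep; exists j, (a 0 j); rewrite mem_iota lt_j; split => //.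
      by rewrite mem_filter mem_enum andbT; case: (slot_flag _) (j == T) no => [] [].
    by rewrite inE => /eqP -> /=; rewrite eqxx.
  + move=> k lt_k E1; apply/eqP/negPn/negP => no.
    set j := T + size (enc_word x) + k in E1 no *.
    have [|p] := H3 [:: (0, (j, a 0 j)); (0, (j.+1, a 0 j.+1))].
      apply/allpairsPdep; exists k, (a 0 j, a 0 j.+1); rewrite mem_iota lt_k; split => //.
      by rewrite mem_filter mem_enum andbT /= E1 eqxx.
    by rewrite !inE => /orP [] /eqP -> /=; rewrite eqxx.
  + move=> t j lt_t lt_j; apply/eqP/negPn/negP => no.
    have [|p] := H4 [:: (t, (j, a t j)); (t, (j.+1, a t j.+1)); (t, (j.+2, a t j.+2));
        (t, (T, a t T)); (t.+1, (j.+1, a t.+1 j.+1))].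
      apply/allpairsPdep; exists (t, j), (a t j, (a t j.+1, (a t j.+2, (a t T, a t.+1 j.+1)))).
      split => //; last by rewrite mem_filter mem_enum no.
      by apply/allpairsP; exists (t, j); rewrite !mem_iota lt_t lt_j.
    by rewrite !inE => /or4P [/eqP ->|/eqP ->|/eqP ->|/orP [] /eqP ->] /=; rewrite eqxx.
  + apply/eqP/negPn/negP => no.
    have [|p] := H5 [:: (T, (T, a T T))].
      by apply/mapP; exists (a T T) => //; rewrite mem_filter mem_enum no.
    by rewrite inE => /eqP -> /=; rewrite eqxx.
- move=> [H1 H2 H3 H4 H5]; split.
  + move=> f /allpairsPdep [j [v [+ + ->]]]; rewrite mem_iota => lt_j.
    rewrite first_rowE (nth_map (Some None)) ?size_column_kinds // mem_filter => /andP [no _].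
    exists (0, (j, v)); first exact: mem_head.
    by apply: contraNneq no => /= <-; apply: H1.
  + move=> f /allpairsPdep [j [v [+ + ->]]]; rewrite mem_iota => lt_j.
    rewrite mem_filter => /andP [/eqP Ev _].
    exists (0, (j, v)); first exact: mem_head.
    apply/eqP => /= E; have := H2 j lt_j; rewrite E Ev.
    by case: (j == T).
  + move=> f /allpairsPdep [k [[v w] [+ + ->]]]; rewrite mem_iota => lt_k.
    rewrite mem_filter => /andP [/andP [/eqP /= E1 E2] _].
    set j := T + size (enc_word x) + k.
    have [E|ne] := eqVneq (a 0 j) v; last first.
      by exists (0, (j, v)); rewrite // mem_head.
    exists (0, (j.+1, w)); first by rewrite !inE eqxx orbT.
    by apply: contraNneq E2 => /= <-; apply/eqP; apply: H3 => //; rewrite -/j E.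
  + move=> f /allpairsPdep [q [[v1 [v2 [v3 [v4 v5]]]] [+ + ->]]].
    move=> /allpairsP [[t j] /= [+ + ->]]; rewrite !mem_iota => lt_t lt_j /=.
    rewrite mem_filter => /andP [/= ne _].
    have [E1|ne1] := eqVneq (a t j) v1; last first.
      by exists (t, (j, v1)); rewrite // !inE eqxx.
    have [E2|ne2] := eqVneq (a t j.+1) v2; last first.
      by exists (t, (j.+1, v2)); rewrite // !inE eqxx ?orbT.
    have [E3|ne3] := eqVneq (a t j.+2) v3; last first.
      by exists (t, (j.+2, v3)); rewrite // !inE eqxx ?orbT.
    have [E4|ne4] := eqVneq (a t T) v4; last first.
      by exists (t, (T, v4)); rewrite // !inE eqxx ?orbT.
    exists (t.+1, (j.+1, v5)); first by rewrite !inE eqxx !orbT.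
    by rewrite /= H4 // E1 E2 E3 E4 eq_sym.
  + move=> f /mapP [v + ->]; rewrite mem_filter => /andP [no _].
    exists (T, (T, v)); first exact: mem_head.
    by apply: contraNneq no => /= <-; rewrite H5.
Qed.

End Tableau.

(** * Valid tableaux and accepting runs *)

Section TableauRun.

Variable M : TM.
Notation G := (symbol M).

Definition run_view (w : word) (R t j : nat) : slot M :=
  view R (iter t (@step M) (init M w)) j.

Lemma tape_cell_input R w j :
  tape_cell R (input_tape G w) j =
  if j < R then None else nth None [seq Some (inl b) | b <- w] (j - R).
Proof.
rewrite /tape_cell /=; case: ifP => _; first by rewrite nth_nil.
by case: w => [|b w] //=; case: (j - R) => [|k] //=; rewrite nth_nil.
Qed.

Lemma view_init R w j (v : slot M) :
  slot_flag v = (j == R) -> slot_state v = start M ->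
  slot_cell v ord0 = (if j < R then None else nth None [seq Some (inl b) | b <- w] (j - R)) ->
  (forall i, i != ord0 -> slot_cell v i = None) ->
  v = view R (init M w) j.
Proof.
case: v => [[b q] f]; rewrite /slot_flag /slot_state /slot_cell /= => -> -> E0 E.
congr (_, _, _); apply/ffunP => i; rewrite !ffunE.
have [->|ne] := eqVneq i ord0; first by rewrite tape_cell_input.
rewrite E // /tape_cell /=.
by case: ifP => _; rewrite ?nth_nil //; case: (j - R) => //= k; rewrite nth_nil.
Qed.

(** Induction on [B]: a leading bit becomes the first letter of the word, while a leading blank
    forces blanks all the way. *)
Lemma certificate_word (c : nat -> cell G) B N : B < N ->
  (forall k, k < B -> fits None (c k)) ->
  (forall k, B <= k -> k < N -> c k = None) ->
  (forall k, k < B -> c k = None -> c k.+1 = None) ->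
  exists2 y : word, size y <= B &
    forall k, k < N -> c k = nth None [seq Some (inl b) | b <- y] k.
Proof.
elim: B c N => [|B IHB] c N lt_BN Hfits Hblank Hmono.
  by exists [::] => // k lt_k; rewrite nth_nil; apply: Hblank.
case E: (c 0) (Hfits 0 isT) => [[b|s]|] // _.
  case: N lt_BN Hblank => // N lt_BN Hblank.
  have [|k lt_k|k le_k lt_k|k lt_k|y size_y Hy] := IHB (c \o S) N.
  - exact: lt_BN.
  - exact: Hfits.
  - exact: Hblank.
  - exact: Hmono.
  by exists (b :: y) => // -[|k] //=; apply: Hy.
exists [::] => // k; rewrite nth_nil; elim: k => // k IHk lt_k.
case: (ltnP k B.+1) => le_k; last by apply: Hblank => //; lia.
by apply: Hmono => //; apply: IHk; lia.
Qed.

Lemma nth_column_kinds x B T j : nth (Some None) (column_kinds x B T) j =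
  if j < T then Some None
  else if j - T < size (enc_word x) then Some (Some (nth false (enc_word x) (j - T)))
  else if j - T - size (enc_word x) < B then None else Some None.
Proof.
rewrite /column_kinds nth_cat size_nseq nth_nseq.
case: ltnP => // _; rewrite nth_cat size_map.
case: ltnP => [lt|_]; first by rewrite (nth_map false).
rewrite nth_cat size_nseq !nth_nseq.
by case: ltnP => // _; case: ifP.
Qed.

Lemma valid_tableau_run x B T y : size y <= B ->
  slot_cell (run_view (enc_pair x y) T T T) ord0 = Some (inl true) ->
  valid_tableau x B T (run_view (enc_pair x y) T).
Proof.
move=> size_y acc.
have cell0 j : slot_cell (run_view (enc_pair x y) T 0 j) ord0 =
    if j < T then None else nth None [seq Some (inl b) | b <- enc_pair x y] (j - T).
  by rewrite /slot_cell /= !ffunE tape_cell_input.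
split => //.
- move=> j lt_j; apply/and3P; split => //.
    rewrite cell0 nth_column_kinds; case: ifP => // _.
    rewrite /enc_pair map_cat nth_cat size_map; case: ltnP => [lt|le].
      by rewrite (nth_map false) //= eqxx.
    case: ltnP => [lt|le'].
      case: (ltnP (j - T - size (enc_word x)) (size y)) => lt'.
        by rewrite (nth_map false).
      by rewrite nth_default // size_map.
    by rewrite nth_default // size_map; apply: leq_trans le'.
  apply/forallP => i; apply/implyP => ne; rewrite /slot_cell !ffunE (negPf ne).
  rewrite /tape_cell /=; case: ifP => _; rewrite ?nth_nil //.
  by case: (j - T) => //= k; rewrite nth_nil.
- move=> k lt_k; rewrite !cell0.
  have -> : T + size (enc_word x) + k < T = false by lia.
  have -> : (T + size (enc_word x) + k).+1 < T = false by lia.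
  rewrite /enc_pair map_cat !nth_cat size_map.
  have -> : T + size (enc_word x) + k - T < size (enc_word x) = false by lia.
  have -> : (T + size (enc_word x) + k).+1 - T < size (enc_word x) = false by lia.
  have -> : T + size (enc_word x) + k - T - size (enc_word x) = k by lia.
  have -> : (T + size (enc_word x) + k).+1 - T - size (enc_word x) = k.+1 by lia.
  case: (ltnP k (size y)) => [lt|le]; first by rewrite (nth_map false).
  by move=> _; rewrite nth_default // size_map; lia.
- by move=> t j _ _; rewrite /run_view iterS view_step.
Qed.

Lemma run_of_valid_tableau x B T (a : nat -> nat -> slot M) : valid_tableau x B T a ->
  exists2 y, size y <= B &
    slot_cell (run_view (enc_pair x y) T T T) ord0 = Some (inl true).
Proof.
move=> [Hfirst Hflag Hcert Hstep Hacc].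
have W_E : columns x B T = T + size (enc_word x) + B + T + 1.
  by rewrite /columns size_enc_word; lia.
pose c k := slot_cell (a 0 (T + size (enc_word x) + k)) ord0.
have kind_c k : nth (Some None) (column_kinds x B T) (T + size (enc_word x) + k) =
    if k < B then None else Some None.
  rewrite nth_column_kinds.
  have -> : T + size (enc_word x) + k < T = false by lia.
  have -> : T + size (enc_word x) + k - T < size (enc_word x) = false by lia.
  by have -> : T + size (enc_word x) + k - T - size (enc_word x) = k by lia.
have Hc k : k < B + T + 1 -> fits (if k < B then None else Some None) (c k).
  move=> lt_k; have /and3P [_ + _] := Hfirst (T + size (enc_word x) + k) ltac:(lia).
  by rewrite kind_c.
(* The length [B + T + 1] reaches exactly to the last column. *)
have [|k lt_k|k le_k lt_k|k lt_k|y size_y Hy] := @certificate_word c B (B + T + 1).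
- lia.
- by have := Hc k ltac:(lia); rewrite lt_k.
- by have := Hc k lt_k; rewrite ltnNge le_k /= => /eqP.
- by rewrite /c addnS; apply: Hcert.
exists y => //.
have row0 j : j < columns x B T -> a 0 j = run_view (enc_pair x y) T 0 j.
  move=> lt_j; have /and3P [/eqP Hs Hfits /forallP Hblank] := Hfirst j lt_j.
  apply: view_init; first exact: Hflag.
  - exact: Hs.
  - move: Hfits; rewrite nth_column_kinds; case: ltnP => [_ /eqP //|le_Tj].
    rewrite /enc_pair map_cat nth_cat size_map; case: ltnP => [lt|le _].
      by rewrite (nth_map false) // => /eqP.
    rewrite -Hy; last by lia.
    by rewrite /c; congr (slot_cell (a 0 _) ord0); lia.
  - by move=> i ne; have := Hblank i; rewrite ne => /eqP.
(* The rows follow the run only inside the light cone, which loses a column on each side per step.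
   Up to time [T] it contains the head column [T], on which every step depends and where the answer
   is read. *)
have rows t : t <= T -> forall j, t <= j -> j + t < columns x B T ->
    a t j = run_view (enc_pair x y) T t j.
  elim: t => [|t IHt] lt_t j le_j lt_j; first by apply: row0; lia.
  case: j le_j lt_j => // j le_j lt_j.
  have W_E' : columns x B T = (T + 2 * size x + B + T).+2 by [].
  rewrite Hstep //; last by lia.
  rewrite /run_view iterS view_step.
  by rewrite !IHt //; lia.
by rewrite -rows //; lia.
Qed.

Lemma iter_step_halting n c : halting (cstate c) -> iter n (@step M) c = c.
Proof. by move=> H; elim: n => //= n ->; rewrite /step H. Qed.

(** Halting configurations are fixed points, so the answer is still there at time [T]; the same
    number [T] also serves as the column of the heads. *)
Lemma accepting_cell w b t T : computes_within M t w [:: b] -> t <= T ->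
  slot_cell (run_view w T T T) ord0 = Some (inl b).
Proof.
move=> [halt out] le_tT; rewrite /run_view -(subnK le_tT) iterD (iter_step_halting _ halt).
rewrite subnK // /slot_cell ffunE /tape_cell ltnn subnn /=.
move: out; rewrite /output /=; case: (tape_head _) => [[b'|s]|] //= [-> _].
by [].
Qed.

End TableauRun.

(** * The reduction from an arbitrary problem in NP *)

Theorem ContainmentExtension_NP_hard : NP_hard ContainmentExtension.
Proof.
move=> L [V [M [c [d HM]]] [e [g HL]]].
pose B (x : word) := e * size x ^ g + e.
(* The base is the largest size of [enc_pair x y] for a certificate [y] of size at most [B x], so
   [T x] bounds the time of the verifier on all of them. *)
pose T x := c * (2 * size x + 1 + B x) ^ d + c.
pose sets x := csp_sets (T x).+1 (columns x (B x) (T x)) (tableau M x (B x) (T x)).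
exists (fun x => encode (sets x) (nseq (size (sets x)) false)).
  apply: computable_poly_time.
  have HB : FP B by rewrite /B; fp.
  have HT : FP T by rewrite /T; fp.
  have Hsets : FP sets.
    apply: FP_csp_sets; first by fp.
      by rewrite /columns; fp.
    by apply: FP_tableau; fp.
  (* Rewriting the empty target as a map lets it be coded as a word, instead of as a list of coded
     bits. *)
  have Ht : FP (fun x => [seq false | _ <- sets x] : word) by fp.
  apply: FP_ext (FP_comp FP_encode (FP_pair Hsets Ht)) _ => x.
  suff -> : nseq (size (sets x)) false = [seq false | _ <- sets x] by [].
  by elim: (sets x) => //= s l ->.
move=> x; rewrite -incomparable_ContainmentExtension HL.
have accE y : size y <= B x ->
    slot_cell (run_view M (enc_pair x y) (T x) (T x) (T x)) ord0 =
    Some (inl (V (enc_pair x y))).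
  move=> size_y; apply: accepting_cell (HM _) _.
  rewrite leq_add2r leq_mul2l leq_expl ?orbT // size_enc_pair; lia.
have equiv : (exists2 y, size y <= B x & V (enc_pair x y)) <->
    exists a, satisfies a (tableau M x (B x) (T x)).
  split.
    move=> [y size_y Vy]; exists (run_view M (enc_pair x y) (T x)).
    by apply/satisfies_tableau/valid_tableau_run; rewrite // accE // Vy.
  move=> [a /satisfies_tableau /run_of_valid_tableau [y size_y]].
  by rewrite accE // => -[Vy]; exists y.
rewrite equiv /sets csp_setsP //.
have W_E : columns x (B x) (T x) = T x + size (enc_word x) + B x + T x + 1.
  by rewrite /columns size_enc_word; lia.
have W_E' : columns x (B x) (T x) = (T x + 2 * size x + B x + T x).+2 by [].
move=> f; rewrite /tableau; move: (columns x (B x) (T x)) W_E W_E' => W W_E W_E'.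
rewrite !mem_cat => /or4P [||| /orP []].
- move=> /allpairsPdep [j [v [+ _ ->]]] p; rewrite mem_iota inE => lt_j /eqP -> /=; lia.
- move=> /allpairsPdep [j [v [+ _ ->]]] p; rewrite mem_iota inE => lt_j /eqP -> /=; lia.
- move=> /allpairsPdep [j [v [+ _ ->]]] p; rewrite mem_iota !inE => lt_j /orP [] /eqP -> /=; lia.
- move=> /allpairsPdep [_ [v [/allpairsP [[t j] /= [+ + ->]] _ ->]]] p.
  rewrite !mem_iota !inE => lt_t lt_j.
  by move=> /or4P [/eqP ->|/eqP ->|/eqP ->|/orP [] /eqP ->] /=; lia.
- by move=> /mapP [v _ ->] p; rewrite inE => /eqP -> /=; lia.
Qed.

Theorem theorem19 : NP_complete ContainmentExtension.
Proof. exact: conj ContainmentExtension_NP ContainmentExtension_NP_hard. Qed.
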